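(* Let $q:\mathbb{Z}^n\to\mathbb{Z}$ be a positive definite connected unit integral quadratic form $q(x)=\sum_{i=1}^n x(i)^2+\sum_{i<j}a_{ij}x(i)x(j)$ with $a_{ij}\in\{-1,0,1\}$. Then there is an isomorphism of Lie algebras $$L(q,\mathfrak{r})\cong L(q)/(\mathfrak{j}),$$ where $L(q)$ is the free complex Lie algebra generated by the set $\{v_1,\ldots,v_n\}$ and $(\mathfrak{j})$ is the ideal of $L(q)$ generated by the set $\mathfrak{j}$ consisting of the following elements: - $[v_i,v_j]$ for all $i,j\in\{1,\ldots,n\}$ such that $i<j$ and $a_{ij}\neq -1$; - $[v_i,[v_i,v_j]]$ for all $i,j\in\{1,\ldots,n\}$ such that $i<j$ and $a_{ij}=-1$; - $[v_j,[v_i,v_j]]$ for all $i,j\in\{1,\ldots,n\}$ such that $i<j$ and $a_{ij}=-1$; - $[v_{i_1},\ldots,v_{i_m}]$ for all positive chordless cycles $(i_1,\ldots,i_m)$ of $q$.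
   Context: Let $e_1,\ldots,e_n$ be the standard basis of $\mathbb{Z}^n$ and put $a_{ji}=a_{ij}$. The form $q$ is connected if the graph on $\{1,\ldots,n\}$ in which $i\neq j$ are joined iff $a_{ij}\neq 0$ is connected. $q$ is positive definite if $q(x)>0$ for all $0\neq x\in\mathbb{Z}^n$. Put $\langle x,y\rangle_q=q(x+y)-q(x)-q(y)$ (so $\langle e_i,e_i\rangle_q=2$ and $\langle e_i,e_j\rangle_q=a_{ij}$ for $i\neq j$). In any Lie algebra, $[y_1,y_2,\ldots,y_m]=[y_1,[y_2,[\ldots[y_{m-1},y_m]]]]$ (and $[y_1]=y_1$). Expressions $[v_{i_1},\ldots,v_{i_m}]$ are called standard multibrackets. A standard multibracket $[v_{i_1},\ldots,v_{i_m}]$ is called a root (a property of the sequence $i_1,\ldots,i_m$) if $m\geq 1$ and $\langle e_{i_k},e_{i_{k+1}}+\cdots+e_{i_m}\rangle_q=-1$ for all $k=1,\ldots,m-1$. Let $\mathfrak{r}\subseteq L(q)$ be the set of all standard multibrackets $[v_{i_1},\ldots,v_{i_m}]$ such that $[v_{i_1},\ldots,v_{i_m}]$ is not a root and $[v_{i_2},\ldots,v_{i_m}]$ is a root; $L(q,\mathfrak{r})=L(q)/(\mathfrak{r})$, where $(\mathfrak{r})$ is the ideal generated by $\mathfrak{r}$. A sequence $(i_1,\ldots,i_m)$, $m\geq 3$, of elements of $\{1,\ldots,n\}$ is a chordless cycle of $q$ if $i_1,\ldots,i_m$ are pairwise different and, for $j\neq k$, $\langle e_{i_j},e_{i_k}\rangle_q\neq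 0$ if and only if $k-j\equiv\pm1$ modulo $m$. It is positive if $\langle e_{i_1},e_{i_m}\rangle_q=1$ and $\langle e_{i_j},e_{i_k}\rangle_q=-1$ for all $j,k$ with $\{j,k\}\neq\{1,m\}$ and $k-j\equiv\pm1$ modulo $m$. *)

(* Defs.v *)
From HB Require Import structures.
From mathcomp Require Import all_boot all_order all_algebra.
From mathcomp Require Import boolp classical_sets reals.
From mathcomp Require Import complex.

Set Implicit Arguments.
Unset Strict Implicit.
Unset Printing Implicit Defensive.

Import Order.TTheory GRing.Theory Num.Theory.

Declare Scope lie_scope.
Delimit Scope lie_scope with lie.

Local Open Scope classical_set_scope.
Local Open Scope ring_scope.
Local Open Scope quotient_scope.

HB.mixin Record Lmodule_isLieAlgebra (K : fieldType) L of GRing.Lmodule K L := {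
  lie : L -> L -> L;
  lieDl : forall x y z, lie (x + y) z = lie x z + lie y z;
  lieDr : forall x y z, lie x (y + z) = lie x y + lie x z;
  lieZl : forall (c : K) x y, lie (c *: x) y = c *: lie x y;
  lieZr : forall (c : K) x y, lie x (c *: y) = c *: lie x y;
  liexx : forall x, lie x x = 0;
  lie_jacobi : forall x y z,
    lie x (lie y z) + lie y (lie z x) + lie z (lie x y) = 0
}.

#[short(type="lieAlgType")]
HB.structure Definition LieAlgebra (K : fieldType) :=
  { L of GRing.Lmodule K L & Lmodule_isLieAlgebra K L }.

Notation "⁅ x , y ⁆" := (lie x y) (at level 0) : lie_scope.
Local Open Scope lie_scope.

Definition lie_morphism (K : fieldType) (L L' : lieAlgType K) (f : L -> L') :=
  linear f /\ forall x y, f ⁅x, y⁆ = ⁅f x, f y⁆.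

Definition lie_isomorphic (K : fieldType) (L L' : lieAlgType K) :=
  exists f : L -> L', lie_morphism f /\ bijective f.

Definition is_lie_ideal (K : fieldType) (L : lieAlgType K) (I : set L) :=
  [/\ I 0, forall (c : K) x y, I x -> I y -> I (c *: x + y)
    & forall x y, I y -> I ⁅x, y⁆].

Record lieIdeal (K : fieldType) (L : lieAlgType K) := LieIdeal {
  ideal_set :> L -> Prop;
  ideal_setP : is_lie_ideal ideal_set
}.

Section LieIdealTheory.
Variables (K : fieldType) (L : lieAlgType K) (I : lieIdeal L).

Lemma lie_ideal0 : I 0.
Proof. by case: (ideal_setP I). Qed.

Lemma lie_idealD x y : I x -> I y -> I (x + y).
Proof. by case: (ideal_setP I) => _ /(_ 1) + _ => /[apply]/[apply]; rewrite scale1r. Qed.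

Lemma lie_idealZ (c : K) x : I x -> I (c *: x).
Proof.
case: (ideal_setP I) => I0 /(_ c) + _ => /[apply]/(_ _ I0).
by rewrite addr0.
Qed.

Lemma lie_idealN x : I x -> I (- x).
Proof. by rewrite -scaleN1r; exact: lie_idealZ. Qed.

Lemma lie_idealr x y : I y -> I ⁅x, y⁆.
Proof. by case: (ideal_setP I) => _ _; exact. Qed.

Lemma lieC (x y : L) : ⁅x, y⁆ = - ⁅y, x⁆.
Proof.
apply/eqP; rewrite -addr_eq0; apply/eqP.
by have := liexx (x + y); rewrite lieDl !lieDr !liexx add0r addr0.
Qed.

Lemma lie_ideall x y : I x -> I ⁅x, y⁆.
Proof. by move=> xI; rewrite lieC; apply/lie_idealN/lie_idealr. Qed.

Definition ideal_mem : {pred L} := fun x => `[< I x >].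

Fact ideal_mem_zmod : zmod_closed ideal_mem.
Proof.
split=> [|x y /asboolP Ix /asboolP Iy]; apply/asboolP; first exact: lie_ideal0.
exact/lie_idealD/lie_idealN.
Qed.

HB.instance Definition _ := GRing.isZmodClosed.Build L ideal_mem ideal_mem_zmod.

Definition lie_quot := Quotient.quot ideal_mem.

HB.instance Definition _ := GRing.Zmodule.on lie_quot.
HB.instance Definition _ := EqQuotient.on lie_quot.

Definition lie_pi (x : L) : lie_quot := \pi_lie_quot x.

Lemma lie_pi_eq x y : lie_pi x = lie_pi y <-> I (x - y).
Proof.
rewrite -(asboolE (I _)) -[`[< _ >]]/(x - y \in ideal_mem).
by rewrite Quotient.idealrBE; split=> /eqP.
Qed.

Lemma lie_piD x y : lie_pi (x + y) = lie_pi x + lie_pi y.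
Proof. by rewrite /lie_pi !piE. Qed.

Lemma lie_pi0 : lie_pi 0 = 0.
Proof. by rewrite /lie_pi !piE. Qed.

Lemma lie_piP (q : lie_quot) : {x | q = lie_pi x}.
Proof. by exists (repr q); rewrite /lie_pi reprK. Qed.

Definition quot_scale (c : K) (p : lie_quot) : lie_quot :=
  lie_pi (c *: repr p).
Definition quot_lie (p q : lie_quot) : lie_quot := lie_pi ⁅repr p, repr q⁆.

Lemma repr_pi x : I (repr (lie_pi x) - x).
Proof. by apply/lie_pi_eq; rewrite /lie_pi reprK. Qed.

Lemma lie_piZ c x : lie_pi (c *: x) = quot_scale c (lie_pi x).
Proof.
apply/esym/lie_pi_eq; rewrite -scalerBr; exact/lie_idealZ/repr_pi.
Qed.

Lemma lie_pi_lie x y : lie_pi ⁅x, y⁆ = quot_lie (lie_pi x) (lie_pi y).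
Proof.
apply/esym/lie_pi_eq; set x' := repr _; set y' := repr _.
have -> : ⁅x', y'⁆ - ⁅x, y⁆ = ⁅x' - x, y'⁆ + ⁅x, y' - y⁆.
  by rewrite lieDl lieDr -(scaleN1r x) -(scaleN1r y) lieZl lieZr !scaleN1r addrA addrNK.
by apply: lie_idealD; [apply: lie_ideall | apply: lie_idealr]; exact: repr_pi.
Qed.

Fact quot_scaleA a b v : quot_scale a (quot_scale b v) = quot_scale (a * b) v.
Proof. by have [x ->] := lie_piP v; rewrite -!lie_piZ scalerA. Qed.

Fact quot_scale1 : left_id 1 quot_scale.
Proof. by move=> v; have [x ->] := lie_piP v; rewrite -lie_piZ scale1r. Qed.

Fact quot_scaleDr : right_distributive quot_scale +%R.
Proof.
move=> c u v; have [x ->] := lie_piP u; have [y ->] := lie_piP v.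
by rewrite -lie_piD -!lie_piZ -lie_piD scalerDr.
Qed.

Fact quot_scaleDl v : {morph quot_scale^~ v : a b / a + b}.
Proof.
by move=> a b; have [x ->] := lie_piP v; rewrite -!lie_piZ -lie_piD scalerDl.
Qed.

HB.instance Definition _ := GRing.Zmodule_isLmodule.Build K lie_quot
  quot_scaleA quot_scale1 quot_scaleDr quot_scaleDl.

Let piZ c x : lie_pi (c *: x) = c *: lie_pi x. Proof. exact: lie_piZ. Qed.

Fact quot_lieDl x y z : quot_lie (x + y) z = quot_lie x z + quot_lie y z.
Proof.
have [a ->] := lie_piP x; have [b ->] := lie_piP y; have [c ->] := lie_piP z.
by rewrite -lie_piD -!lie_pi_lie -lie_piD lieDl.
Qed.

Fact quot_lieDr x y z : quot_lie x (y + z) = quot_lie x y + quot_lie x z.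
Proof.
have [a ->] := lie_piP x; have [b ->] := lie_piP y; have [c ->] := lie_piP z.
by rewrite -lie_piD -!lie_pi_lie -lie_piD lieDr.
Qed.

Fact quot_lieZl (c : K) x y : quot_lie (c *: x) y = c *: quot_lie x y.
Proof.
have [a ->] := lie_piP x; have [b ->] := lie_piP y.
by rewrite -piZ -!lie_pi_lie -piZ lieZl.
Qed.

Fact quot_lieZr (c : K) x y : quot_lie x (c *: y) = c *: quot_lie x y.
Proof.
have [a ->] := lie_piP x; have [b ->] := lie_piP y.
by rewrite -piZ -!lie_pi_lie -piZ lieZr.
Qed.

Fact quot_liexx x : quot_lie x x = 0.
Proof. by have [a ->] := lie_piP x; rewrite -lie_pi_lie liexx lie_pi0. Qed.

Fact quot_lie_jacobi x y z :
  quot_lie x (quot_lie y z) + quot_lie y (quot_lie z x)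
  + quot_lie z (quot_lie x y) = 0.
Proof.
have [a ->] := lie_piP x; have [b ->] := lie_piP y; have [c ->] := lie_piP z.
by rewrite -!lie_pi_lie -!lie_piD lie_jacobi lie_pi0.
Qed.

HB.instance Definition _ := Lmodule_isLieAlgebra.Build K lie_quot
  quot_lieDl quot_lieDr quot_lieZl quot_lieZr quot_liexx quot_lie_jacobi.

Lemma lie_pi_morphism : lie_morphism lie_pi.
Proof.
split=> [c x y | x y]; last exact: lie_pi_lie.
by rewrite lie_piD piZ.
Qed.

Lemma lie_pi_eq0 x : lie_pi x = 0 <-> I x.
Proof. by rewrite -lie_pi0 lie_pi_eq subr0. Qed.

End LieIdealTheory.

Section IdealGen.
Variables (K : fieldType) (L : lieAlgType K) (S : set L).

Fact smallest_ideal : is_lie_ideal (smallest (@is_lie_ideal K L) S).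
Proof.
split=> [I [] [] //|c x y Ix Iy I [idI SI]|x y Iy I [idI SI]].
  by have [_ + _] := idI; apply; [exact: Ix | exact: Iy].
by have [_ _] := idI; apply; exact: Iy.
Qed.

Definition ideal_gen : lieIdeal L := LieIdeal smallest_ideal.

End IdealGen.

(* Formal expressions modulo the congruence generated by the axioms of a Lie
   algebra; see [free_lie_universal] for the universal property. *)
Inductive lie_term (K : fieldType) (X : Type) :=
| LVar of X
| LZero
| LAdd of lie_term K X & lie_term K X
| LScale of K & lie_term K X
| LLie of lie_term K X & lie_term K X.

Arguments LVar {K X}.
Arguments LZero {K X}.

HB.instance Definition _ (K : fieldType) X := gen_eqMixin (lie_term K X).
HB.instance Definition _ (K : fieldType) X := gen_choiceMixin (lie_term K X).

Inductive lie_term_eq (K : fieldType) (X : Type) :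
    lie_term K X -> lie_term K X -> Prop :=
| LE_refl t : lie_term_eq t t
| LE_sym t u : lie_term_eq t u -> lie_term_eq u t
| LE_trans t u v : lie_term_eq t u -> lie_term_eq u v -> lie_term_eq t v
| LE_add t t' u u' : lie_term_eq t t' -> lie_term_eq u u' ->
    lie_term_eq (LAdd t u) (LAdd t' u')
| LE_scale c t t' : lie_term_eq t t' -> lie_term_eq (LScale c t) (LScale c t')
| LE_lie t t' u u' : lie_term_eq t t' -> lie_term_eq u u' ->
    lie_term_eq (LLie t u) (LLie t' u')
| LE_addA t u v : lie_term_eq (LAdd t (LAdd u v)) (LAdd (LAdd t u) v)
| LE_addC t u : lie_term_eq (LAdd t u) (LAdd u t)
| LE_add0 t : lie_term_eq (LAdd LZero t) t
| LE_addN t : lie_term_eq (LAdd (LScale (-1) t) t) LZero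
| LE_scaleA b c t : lie_term_eq (LScale b (LScale c t)) (LScale (b * c) t)
| LE_scale1 t : lie_term_eq (LScale 1 t) t
| LE_scaleDr c t u :
    lie_term_eq (LScale c (LAdd t u)) (LAdd (LScale c t) (LScale c u))
| LE_scaleDl b c t :
    lie_term_eq (LScale (b + c) t) (LAdd (LScale b t) (LScale c t))
| LE_lieDl t u v : lie_term_eq (LLie (LAdd t u) v) (LAdd (LLie t v) (LLie u v))
| LE_lieDr t u v : lie_term_eq (LLie t (LAdd u v)) (LAdd (LLie t u) (LLie t v))
| LE_lieZl c t u : lie_term_eq (LLie (LScale c t) u) (LScale c (LLie t u))
| LE_lieZr c t u : lie_term_eq (LLie t (LScale c u)) (LScale c (LLie t u))
| LE_liexx t : lie_term_eq (LLie t t) LZero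
| LE_jacobi t u v :
    lie_term_eq (LAdd (LAdd (LLie t (LLie u v)) (LLie u (LLie v t)))
                      (LLie v (LLie t u))) LZero.

Section FreeLie.
Variables (K : fieldType) (X : Type).
Local Notation T := (lie_term K X).

Definition lie_term_eqb (t u : T) : bool := `[< lie_term_eq t u >].

Fact lie_term_eqb_refl : reflexive lie_term_eqb.
Proof. by move=> t; apply/asboolP; exact: LE_refl. Qed.

Fact lie_term_eqb_sym : symmetric lie_term_eqb.
Proof. by move=> t u; apply/asboolP/asboolP; exact: LE_sym. Qed.

Fact lie_term_eqb_trans : transitive lie_term_eqb.
Proof. by move=> u t v /asboolP tu /asboolP uv; apply/asboolP/(LE_trans tu). Qed.

Canonical lie_term_equiv :=
  EquivRel lie_term_eqb lie_term_eqb_refl lie_term_eqb_sym lie_term_eqb_trans.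

Definition free_lie := {eq_quot lie_term_eqb}.

HB.instance Definition _ := Choice.on free_lie.
HB.instance Definition _ := EqQuotient.on free_lie.

Definition fl_pi (t : T) : free_lie := \pi_free_lie t.

Lemma fl_pi_eq t u : fl_pi t = fl_pi u <-> lie_term_eq t u.
Proof.
split=> [/eqmodP /asboolP //|tu].
by apply/eqmodP/asboolP.
Qed.

Lemma fl_piP (x : free_lie) : {t | x = fl_pi t}.
Proof. by exists (repr x); rewrite /fl_pi reprK. Qed.

Lemma fl_repr t : lie_term_eq (repr (fl_pi t)) t.
Proof. by apply/fl_pi_eq; rewrite /fl_pi reprK. Qed.

Definition fl_add (x y : free_lie) : free_lie := fl_pi (LAdd (repr x) (repr y)).
Definition fl_scale (c : K) (x : free_lie) : free_lie :=
  fl_pi (LScale c (repr x)).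
Definition fl_lie (x y : free_lie) : free_lie := fl_pi (LLie (repr x) (repr y)).

Lemma fl_addE t u : fl_add (fl_pi t) (fl_pi u) = fl_pi (LAdd t u).
Proof. by apply/fl_pi_eq/LE_add; exact: fl_repr. Qed.

Lemma fl_scaleE c t : fl_scale c (fl_pi t) = fl_pi (LScale c t).
Proof. by apply/fl_pi_eq/LE_scale; exact: fl_repr. Qed.

Lemma fl_lieE t u : fl_lie (fl_pi t) (fl_pi u) = fl_pi (LLie t u).
Proof. by apply/fl_pi_eq/LE_lie; exact: fl_repr. Qed.

Let flE := (fl_addE, fl_scaleE, fl_lieE).

Fact fl_addA : associative fl_add.
Proof.
move=> x y z; have [t ->] := fl_piP x; have [u ->] := fl_piP y.
by have [v ->] := fl_piP z; rewrite !flE; apply/fl_pi_eq; constructor.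
Qed.

Fact fl_addC : commutative fl_add.
Proof.
move=> x y; have [t ->] := fl_piP x; have [u ->] := fl_piP y.
by rewrite !flE; apply/fl_pi_eq; apply: LE_addC.
Qed.

Fact fl_add0 : left_id (fl_pi LZero) fl_add.
Proof.
by move=> x; have [t ->] := fl_piP x; rewrite !flE; apply/fl_pi_eq; apply: LE_add0.
Qed.

Fact fl_addN : left_inverse (fl_pi LZero) (fl_scale (-1)) fl_add.
Proof.
by move=> x; have [t ->] := fl_piP x; rewrite !flE; apply/fl_pi_eq; apply: LE_addN.
Qed.

HB.instance Definition _ :=
  GRing.isZmodule.Build free_lie fl_addA fl_addC fl_add0 fl_addN.

Let addE t u : fl_pi t + fl_pi u = fl_pi (LAdd t u).
Proof. exact: fl_addE. Qed.

Fact fl_scaleA b c x : fl_scale b (fl_scale c x) = fl_scale (b * c) x.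
Proof.
have [t ->] := fl_piP x; rewrite !flE; apply/fl_pi_eq; exact: LE_scaleA.
Qed.

Fact fl_scale1 : left_id 1 fl_scale.
Proof.
move=> x; have [t ->] := fl_piP x; rewrite !flE; apply/fl_pi_eq; exact: LE_scale1.
Qed.

Fact fl_scaleDr : right_distributive fl_scale +%R.
Proof.
move=> c x y; have [t ->] := fl_piP x; have [u ->] := fl_piP y.
by rewrite !(addE, flE); apply/fl_pi_eq; exact: LE_scaleDr.
Qed.

Fact fl_scaleDl x : {morph fl_scale^~ x : b c / b + c}.
Proof.
move=> b c; have [t ->] := fl_piP x.
by rewrite !(addE, flE); apply/fl_pi_eq; exact: LE_scaleDl.
Qed.

HB.instance Definition _ := GRing.Zmodule_isLmodule.Build K free_lie
  fl_scaleA fl_scale1 fl_scaleDr fl_scaleDl.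

Let scaleE c t : c *: fl_pi t = fl_pi (LScale c t).
Proof. exact: fl_scaleE. Qed.

Fact fl_lieDl x y z : fl_lie (x + y) z = fl_lie x z + fl_lie y z.
Proof.
have [t ->] := fl_piP x; have [u ->] := fl_piP y; have [v ->] := fl_piP z.
by rewrite !(addE, flE); apply/fl_pi_eq; exact: LE_lieDl.
Qed.

Fact fl_lieDr x y z : fl_lie x (y + z) = fl_lie x y + fl_lie x z.
Proof.
have [t ->] := fl_piP x; have [u ->] := fl_piP y; have [v ->] := fl_piP z.
by rewrite !(addE, flE); apply/fl_pi_eq; exact: LE_lieDr.
Qed.

Fact fl_lieZl (c : K) x y : fl_lie (c *: x) y = c *: fl_lie x y.
Proof.
have [t ->] := fl_piP x; have [u ->] := fl_piP y.
by rewrite scaleE !fl_lieE scaleE; apply/fl_pi_eq; exact: LE_lieZl.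
Qed.

Fact fl_lieZr (c : K) x y : fl_lie x (c *: y) = c *: fl_lie x y.
Proof.
have [t ->] := fl_piP x; have [u ->] := fl_piP y.
by rewrite scaleE !fl_lieE scaleE; apply/fl_pi_eq; exact: LE_lieZr.
Qed.

Fact fl_liexx x : fl_lie x x = 0.
Proof.
by have [t ->] := fl_piP x; rewrite !flE; apply/fl_pi_eq; exact: LE_liexx.
Qed.

Fact fl_lie_jacobi x y z :
  fl_lie x (fl_lie y z) + fl_lie y (fl_lie z x) + fl_lie z (fl_lie x y) = 0.
Proof.
have [t ->] := fl_piP x; have [u ->] := fl_piP y; have [v ->] := fl_piP z.
by rewrite !(addE, flE); apply/fl_pi_eq; exact: LE_jacobi.
Qed.

HB.instance Definition _ := Lmodule_isLieAlgebra.Build K free_lie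
  fl_lieDl fl_lieDr fl_lieZl fl_lieZr fl_liexx fl_lie_jacobi.

Definition free_gen (x : X) : free_lie := fl_pi (LVar x).

Section Universal.
Variables (L : lieAlgType K) (g : X -> L).

Fixpoint lie_eval (t : T) : L :=
  match t with
  | LVar x => g x
  | LZero => 0
  | LAdd t u => lie_eval t + lie_eval u
  | LScale c t => c *: lie_eval t
  | LLie t u => ⁅lie_eval t, lie_eval u⁆
  end.

Lemma lie_eval_eq t u : lie_term_eq t u -> lie_eval t = lie_eval u.
Proof.
elim=> {t u} //=; try congruence.
- by move=> *; rewrite addrA.
- by move=> *; rewrite addrC.
- by move=> *; rewrite add0r.
- by move=> *; rewrite scaleN1r addNr.
- by move=> *; rewrite scalerA.
- by move=> *; rewrite scale1r.
- by move=> *; rewrite scalerDr.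
- by move=> *; rewrite scalerDl.
- by move=> *; rewrite lieDl.
- by move=> *; rewrite lieDr.
- by move=> *; rewrite lieZl.
- by move=> *; rewrite lieZr.
- by move=> *; rewrite liexx.
- by move=> *; rewrite lie_jacobi.
Qed.

Definition free_lift (x : free_lie) : L := lie_eval (repr x).

Lemma free_liftE t : free_lift (fl_pi t) = lie_eval t.
Proof. by apply: lie_eval_eq; exact: fl_repr. Qed.

Lemma free_lie_universal :
  exists! f : free_lie -> L,
    lie_morphism f /\ forall x, f (free_gen x) = g x.
Proof.
exists free_lift; split.
  split=> [|x]; last by rewrite free_liftE.
  split=> [c x y|x y]; have [t ->] := fl_piP x; have [u ->] := fl_piP y.
    by rewrite scaleE addE !free_liftE.
  by rewrite /lie /= fl_lieE !free_liftE.
move=> f [[f_lin f_lie] fg]; apply/funext => x.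
have fD y z : f (y + z) = f y + f z by rewrite -[y]scale1r f_lin !scale1r.
have f0 : f 0 = 0 by apply: (addrI (f 0)); rewrite -fD !addr0.
have fZ c y : f (c *: y) = c *: f y by rewrite -[c *: y]addr0 f_lin f0 addr0.
have [t ->] := fl_piP x; rewrite free_liftE.
elim: t => [y||t IHt u IHu|c t IHt|t IHt u IHu] /=.
- by rewrite -fg.
- by rewrite -f0.
- by rewrite -addE fD IHt IHu.
- by rewrite -scaleE fZ IHt.
- by rewrite -fl_lieE f_lie IHt IHu.
Qed.

End Universal.

End FreeLie.

Arguments free_gen {K X}.

Definition multibracket (K : fieldType) (L : lieAlgType K) :=
  fix mb (s : seq L) : L :=
    match s with
    | [::] => 0
    | [:: y] => y
    | y :: s' => ⁅y, mb s'⁆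
    end.

Section QuadraticForms.
Variable n : nat.
Implicit Type q : 'rV[int]_n -> int.

(* Only the entries [a i j] with [i < j] are relevant. *)
Definition unit_form (a : 'I_n -> 'I_n -> int) (x : 'rV[int]_n) : int :=
  \sum_(i < n) x 0 i ^+ 2 +
  \sum_(i < n) \sum_(j < n | (i < j)%N) a i j * x 0 i * x 0 j.

Definition sym_coef (a : 'I_n -> 'I_n -> int) (i j : 'I_n) : int :=
  if (i < j)%N then a i j else a j i.

Definition positive_definite q := forall x, x != 0 -> 0 < q x.

Definition form_connected (a : 'I_n -> 'I_n -> int) :=
  forall i j, connect (fun k l => (k != l) && (sym_coef a k l != 0)) i j.

Definition bform q (x y : 'rV[int]_n) : int := q (x + y) - q x - q y.

Definition ebasis (i : 'I_n) : 'rV[int]_n := delta_mx 0 i.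

(* Positions in a sequence are numbered from 0. *)
Definition is_root q (s : seq 'I_n) : Prop :=
  (1 <= size s)%N /\
  forall k : 'I_(size s), (k.+1 < size s)%N ->
    bform q (ebasis (tnth (in_tuple s) k))
            (\sum_(i <- drop k.+1 s) ebasis i) = -1.

Definition cyclic_neighbours (m j k : nat) : bool :=
  (k%:Z - j%:Z == 1 %[mod m%:Z])%Z || (k%:Z - j%:Z == -1 %[mod m%:Z])%Z.

Definition are_endpoints (m j k : nat) : bool :=
  ((j == 0) && (k == m.-1) || (j == m.-1) && (k == 0))%N.

Definition chordless_cycle q m (c : m.-tuple 'I_n) : Prop :=
  [/\ (3 <= m)%N, uniq c &
      forall j k : 'I_m, j != k ->
        bform q (ebasis (tnth c j)) (ebasis (tnth c k)) != 0 <->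
        cyclic_neighbours m j k].

Definition positive_chordless_cycle q m (c : m.-tuple 'I_n) : Prop :=
  [/\ chordless_cycle q c,
      forall j k : 'I_m, j = 0%N :> nat -> k = m.-1 :> nat ->
        bform q (ebasis (tnth c j)) (ebasis (tnth c k)) = 1 &
      forall j k : 'I_m, ~~ are_endpoints m j k -> cyclic_neighbours m j k ->
        bform q (ebasis (tnth c j)) (ebasis (tnth c k)) = -1].

End QuadraticForms.

Section FormLie.
Variables (K : fieldType) (n : nat).

(* [L(q)] depends only on the number [n] of variables of [q]. *)
Definition form_lie : lieAlgType K := free_lie K 'I_n.

Definition vgen (i : 'I_n) : form_lie := free_gen i.

Definition vbracket (s : seq 'I_n) : form_lie := multibracket (map vgen s).

Definition rel_r (q : 'rV[int]_n -> int) : set form_lie :=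
  [set x | exists (i : 'I_n) (s : seq 'I_n),
     [/\ ~ is_root q (i :: s), is_root q s & x = vbracket (i :: s)]].

Definition rel_j (a : 'I_n -> 'I_n -> int) : set form_lie :=
  [set x | exists i j : 'I_n,
     [/\ (i < j)%N, a i j != -1 & x = ⁅vgen i, vgen j⁆]] `|`
  [set x | exists i j : 'I_n,
     [/\ (i < j)%N, a i j = -1 & x = ⁅vgen i, ⁅vgen i, vgen j⁆⁆]] `|`
  [set x | exists i j : 'I_n,
     [/\ (i < j)%N, a i j = -1 & x = ⁅vgen j, ⁅vgen i, vgen j⁆⁆]] `|`
  [set x | exists m (c : m.-tuple 'I_n),
     positive_chordless_cycle (unit_form a) c /\ x = vbracket c].

End FormLie.

Arguments rel_r K {n} q.
Arguments rel_j K {n} a.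

(* Main.v *)
Require Import Defs.
From mathcomp Require Import all_boot all_order all_algebra.
From mathcomp Require Import boolp classical_sets reals.
From mathcomp Require Import complex.
From mathcomp Require Import zify ring.

Set Implicit Arguments.
Unset Strict Implicit.
Unset Printing Implicit Defensive.

Import Order.TTheory GRing.Theory Num.Theory.
Local Open Scope ring_scope.
Local Open Scope lie_scope.

(** The two quotients coincide because the two families generate the same ideal
    of the free Lie algebra.  The elements of the second family lie in the first
    ideal by direct inspection: each of them is, up to sign, [v_i, w] with w a root
    bracket and [v_i, w] not a root bracket ([rel_j_sub_r]).

    For the converse, work in the quotient by the second ideal, and more
    generally in any Lie algebra with elements v_i satisfying the second family
    of relations.  A word s in the indices stands for the vector of N^n that
    counts its letters; write q(s) for the value of the form and s.t for the
    associated bilinear form.  The claim, [monomial_zero], is that a Lie monomial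
    of degree s vanishes unless q(s) = 1.  It gives the theorem: if w is a root
    bracket of degree s, then q(s) = 1, and if [v_i, w] is not a root bracket,
    then i.s <> -1, whence q(i s) = 2 + i.s <> 1.

    The claim is proved by induction on the length of the degree.  The induction
    hypothesis says that shorter monomials x and y of degrees s and t commute as
    soon as s.t <> -1 ([monomial_comm]).  As monomials are combinations of
    standard multibrackets, it suffices to treat [v_i, [v_j, y]], where y is a
    multibracket of degree t with q(t) = 1 and j.t = -1.  Expanding with the
    Jacobi identity and the induction hypothesis, this is 0 or an instance of a
    Serre relation except in three situations: i = j, which is the Serre relation
    propagated along y ([lie_twice_zero]); i.j = 1 with i.t = -1; and i.j = -1
    with i.t = 1.  In the last two, i, j and t form a triangle with exactly one
    product equal to +1 and the others equal to -1.

    Such a triangle is refined into a cycle: a composite block t whose two ends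
    are attached to chains of single letters.  Splitting the first letter l off
    t = l t', one finds that either the bracket vanishes by the induction
    hypothesis, or l extends a chain or starts a new one and the block becomes t'
    ([two_chains_zero] and [closing_block_zero], according to whether the +1 sits
    between two letters or between a letter and the block).  What must be
    excluded is a chord from l to the middle of a chain, and this is where
    positive definiteness enters: with a chord, three blocks with pairwise
    products -1 would have sum of norm 0, or a block would equal a sum of
    others, or the bracket vanishes ([chord_zero], [closing_block_cut]).
    When the block is a single letter, the letters form a positive
    chordless cycle and the bracket is, up to sign, the cycle relation. *)

(** * Brackets in a Lie algebra *)

Section LieCalculus.
Variables (K : fieldType) (L : lieAlgType K).
Implicit Types x y z : L.

Lemma lie0r x : ⁅x, 0⁆ = 0.
Proof. by apply: (addrI ⁅x, 0⁆); rewrite -lieDr !addr0. Qed.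

Lemma lie0l x : ⁅0, x⁆ = 0.
Proof. by rewrite lieC lie0r oppr0. Qed.

Lemma lieNr x y : ⁅x, - y⁆ = - ⁅x, y⁆.
Proof. by rewrite -scaleN1r lieZr scaleN1r. Qed.

Lemma lieNl x y : ⁅- x, y⁆ = - ⁅x, y⁆.
Proof. by rewrite lieC lieNr -lieC. Qed.

(** The Jacobi identity: bracketing with x is a derivation. *)
Lemma lie_der x y z : ⁅x, ⁅y, z⁆⁆ = ⁅⁅x, y⁆, z⁆ + ⁅y, ⁅x, z⁆⁆.
Proof.
apply/eqP; rewrite -subr_eq0 opprD -lieC addrA -lieNr -lieC; apply/eqP.
by rewrite -[RHS](lie_jacobi x y z) addrAC.
Qed.

Lemma lie_lieE x y z : ⁅⁅x, y⁆, z⁆ = ⁅x, ⁅y, z⁆⁆ - ⁅y, ⁅x, z⁆⁆.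
Proof. by rewrite lie_der addrK. Qed.

Lemma lie_swap x y z : ⁅x, y⁆ = 0 -> ⁅x, ⁅y, z⁆⁆ = ⁅y, ⁅x, z⁆⁆.
Proof. by move=> xy0; rewrite lie_der xy0 lie0l add0r. Qed.

Lemma lie_push x y z : ⁅x, z⁆ = 0 -> ⁅x, ⁅y, z⁆⁆ = ⁅⁅x, y⁆, z⁆.
Proof. by move=> xz0; rewrite lie_der xz0 lie0r addr0. Qed.

Lemma lie_centr x y z : ⁅x, y⁆ = 0 -> ⁅x, z⁆ = 0 -> ⁅x, ⁅y, z⁆⁆ = 0.
Proof. by move=> xy0 xz0; rewrite lie_swap // xz0 lie0r. Qed.

End LieCalculus.

(** * The quadratic form on words *)

Section WordForm.
Variables (n : nat) (a : 'I_n -> 'I_n -> int).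
Implicit Types (x y : 'rV[int]_n) (s t u : seq 'I_n).
Notation q := (unit_form a).

Lemma bformE x y : bform q x y =
  \sum_(i < n) 2 * (x 0 i * y 0 i)
  + \sum_(i < n) \sum_(j < n | (i < j)%N)
      a i j * (x 0 i * y 0 j + y 0 i * x 0 j).
Proof.
suff : q (x + y) = q x + q y + (\sum_(i < n) 2 * (x 0 i * y 0 i)
  + \sum_(i < n) \sum_(j < n | (i < j)%N)
      a i j * (x 0 i * y 0 j + y 0 i * x 0 j)).
  by rewrite /bform => ->; ring.
rewrite /unit_form [X in _ = X]addrACA [X in X + _ = _](_ : _ =
  \sum_(i < n) x 0 i ^+ 2 + \sum_(i < n) y 0 i ^+ 2
  + \sum_(i < n) 2 * (x 0 i * y 0 i)); last first.
  by rewrite -!big_split /=; apply: eq_bigr => i _; rewrite !mxE; ring.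
rewrite [X in _ + X = _](_ : _ =
  \sum_(i < n) \sum_(j < n | (i < j)%N) a i j * x 0 i * x 0 j
  + \sum_(i < n) \sum_(j < n | (i < j)%N) a i j * y 0 i * y 0 j
  + \sum_(i < n) \sum_(j < n | (i < j)%N)
      a i j * (x 0 i * y 0 j + y 0 i * x 0 j)); first ring.
rewrite -!big_split /=; apply: eq_bigr => i _.
by rewrite -!big_split /=; apply: eq_bigr => j _; rewrite !mxE; ring.
Qed.

Lemma bformC x y : bform q x y = bform q y x.
Proof. by rewrite /bform [y + x]addrC; ring. Qed.

Lemma bformDr x y z : bform q x (y + z) = bform q x y + bform q x z.
Proof.
rewrite !bformE addrACA; congr (_ + _); rewrite -big_split /=.
  by apply: eq_bigr => i _; rewrite !mxE; ring.
apply: eq_bigr => i _; rewrite -big_split /=.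
by apply: eq_bigr => j _; rewrite !mxE; ring.
Qed.

Lemma unit_formB x y : q (x - y) = q x + q y - bform q x y.
Proof.
have b0 : bform q x 0 = 0 by apply: (addrI (bform q x 0)); rewrite -bformDr !addr0.
have := bformDr x y (- y); rewrite subrr b0.
have -> : bform q x (- y) = q (x - y) - q x - q y.
  rewrite /bform; congr (_ - _); rewrite /unit_form; congr (_ + _).
    by apply: eq_bigr => i _; rewrite !mxE sqrrN.
  by apply: eq_bigr => i _; apply: eq_bigr => j _; rewrite !mxE; ring.
lia.
Qed.

Lemma ebasisE (i k : 'I_n) : ebasis i 0 k = (i == k)%:R.
Proof. by rewrite /ebasis mxE eqxx eq_sym. Qed.

Lemma unit_form_ebasis (i : 'I_n) : q (ebasis i) = 1.
Proof.
rewrite /unit_form (bigD1 i) //= ebasisE eqxx expr1n big1 => [|k ki]; last first.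
  by rewrite ebasisE eq_sym (negPf ki) expr0n.
rewrite big1 ?addr0 // => k _; rewrite big1 // => l kl.
rewrite !ebasisE; case: eqVneq => [ik|]; last by rewrite mulr0 mul0r.
by case: eqVneq => [il|]; [move: kl; rewrite -ik -il ltnn | rewrite mulr0].
Qed.

Lemma bform_ebasis (i j : 'I_n) : (i < j)%N -> bform q (ebasis i) (ebasis j) = a i j.
Proof.
move=> ij; have nij : i != j by rewrite neq_ltn ij.
rewrite bformE big1 => [|k _]; last first.
  rewrite !ebasisE; case: eqVneq => [<-|]; last by rewrite !mul0r mulr0.
  by rewrite eq_sym (negPf nij) !mulr0.
rewrite add0r (bigD1 i) //= [X in _ + X]big1 => [|k ki].
  rewrite addr0 (bigD1 j) //= big1 => [|k /andP[ik kj]].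
    by rewrite !ebasisE !eqxx (negPf nij) mulr0 addr0 !mulr1.
  by rewrite !ebasisE (eq_sym j i) (eq_sym j k) (negPf nij) (negPf kj) mul0r mulr0 addr0 mulr0.
rewrite big1 // => l kl; rewrite !ebasisE (eq_sym i k) (negPf ki) mul0r add0r.
case: (eqVneq j k) => [jk|]; last by rewrite mul0r mulr0.
by case: (eqVneq i l) => [il|]; [move: kl; rewrite -il -jk ltnNge (ltnW ij) | rewrite !mulr0].
Qed.

(** Words are used in place of vectors with nonnegative entries: the weight
    forgets the order of the letters, and lengths serve as an induction
    measure. *)
Definition weight s : 'rV[int]_n := \sum_(i <- s) ebasis i.
Definition qw s : int := q (weight s).
Definition bw s t : int := bform q (weight s) (weight t).

Lemma weight_cat s t : weight (s ++ t) = weight s + weight t.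
Proof. exact: big_cat. Qed.

Lemma weight1 i : weight [:: i] = ebasis i.
Proof. exact: big_seq1. Qed.

Lemma weightE s i : weight s 0 i = (count_mem i s)%:Z.
Proof.
elim: s => [|j s IHs]; first by rewrite /weight big_nil mxE.
by rewrite -cat1s weight_cat mxE IHs weight1 ebasisE cat1s /= PoszD natz.
Qed.

Lemma bwC s t : bw s t = bw t s. Proof. exact: bformC. Qed.

Lemma bw_catr s t u : bw s (t ++ u) = bw s t + bw s u.
Proof. by rewrite /bw weight_cat bformDr. Qed.

Lemma bw_catl s t u : bw (s ++ t) u = bw s u + bw t u.
Proof. by rewrite ![bw _ u]bwC bw_catr. Qed.

Lemma bw_consr s i t : bw s (i :: t) = bw s [:: i] + bw s t.
Proof. by rewrite -cat1s bw_catr. Qed.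

Lemma bw_consl i s t : bw (i :: s) t = bw [:: i] t + bw s t.
Proof. by rewrite -cat1s bw_catl. Qed.

Lemma bw_nilr s : bw s [::] = 0.
Proof. by have := bw_catr s [::] [::]; rewrite /=; lia. Qed.

Lemma bw_nill s : bw [::] s = 0.
Proof. by rewrite bwC bw_nilr. Qed.

Lemma qw_cat s t : qw (s ++ t) = qw s + qw t + bw s t.
Proof. by rewrite /bw /bform /qw weight_cat; ring. Qed.

Lemma qw1 i : qw [:: i] = 1.
Proof. by rewrite /qw weight1 unit_form_ebasis. Qed.

Lemma qw_cons i s : qw (i :: s) = 1 + qw s + bw [:: i] s.
Proof. by rewrite -cat1s qw_cat qw1. Qed.

Lemma unit_form0 : q 0 = 0.
Proof.
rewrite /unit_form big1 ?add0r => [|i _]; last by rewrite mxE expr0n.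
by rewrite big1 // => i _; rewrite big1 // => j _; rewrite !mxE !mulr0.
Qed.

Lemma bw_diag s : bw s s = 2 * qw s.
Proof.
have := unit_formB (weight s) (weight s).
rewrite subrr unit_form0 /bw /qw => /esym/subr0_eq <-; ring.
Qed.

Lemma weight_perm s t : perm_eq s t -> weight s = weight t.
Proof. by move=> st; apply: perm_big. Qed.

Lemma qw_perm s t : perm_eq s t -> qw s = qw t.
Proof. by rewrite /qw => /weight_perm ->. Qed.

Lemma bw_permr s t u : perm_eq t u -> bw s t = bw s u.
Proof. by rewrite /bw => /weight_perm ->. Qed.

(** The coordinate of [weight s] at i counts the occurrences of i in s. *)
Lemma weight_inj s t : weight s = weight t -> perm_eq s t.
Proof.
move=> st; apply/allP => i _ /=.
by apply/eqP; have := weightE s i; rewrite st weightE => -[].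
Qed.

Hypothesis q_posdef : positive_definite q.

Lemma qw_gt0 s : s != [::] -> 0 < qw s.
Proof.
move=> s0; apply: q_posdef; apply: contra s0 => /eqP ws0.
have /weight_inj/perm_nilP -> // : weight s = weight [::] by rewrite ws0 /weight big_nil.
Qed.

(** The defect is the value of the form at the difference of the weights. *)
Lemma bw_le s t : bw s t <= qw s + qw t.
Proof.
rewrite -subr_ge0 -unit_formB.
have [->|/q_posdef/ltW //] := eqVneq (weight s - weight t) 0.
by rewrite unit_form0.
Qed.

(** By definiteness, a difference of weights on which the form vanishes is 0. *)
Lemma bw_eq s t : bw s t = qw s + qw t -> perm_eq s t.
Proof.
move=> st; apply: weight_inj; apply/eqP; rewrite -subr_eq0.
by apply/negP => /negP/q_posdef; rewrite unit_formB -/(qw s) -/(qw t) -/(bw s t) st subrr ltxx.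
Qed.

(** A product -2 would make the sum of the weights, which is nonzero because
    its entries are nonnegative, isotropic. *)
Lemma bw_ge s t : s != [::] -> qw s = 1 -> qw t = 1 -> -1 <= bw s t.
Proof.
move=> s0 qs qt; have : 0 < qw (s ++ t); last by rewrite qw_cat; lia.
by apply: qw_gt0; case: (s) s0.
Qed.

End WordForm.

(** * Chordless chains and positive cycles *)

Section Chains.
Variables (n : nat) (a : 'I_n -> 'I_n -> int).
Implicit Types (i j l : 'I_n) (r s t u : seq 'I_n).
Local Notation "s ∙ t" := (bw a s t) (at level 40).

Definition apart s t := all (fun i => [:: i] ∙ t == 0) s.

(** Chains grow at their head, so a block t is attached to s through the head
    of s and to no other letter of s. *)
Definition attached s t :=
  if s is i :: s' then ([:: i] ∙ t == -1) && apart s' t else false.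

Fixpoint chain s :=
  if s is i :: s' then (nilp s' || attached s' [:: i]) && chain s' else true.

(** The last letter of s is the one joined to t by the +1 edge that closes a
    positive cycle. *)
Definition closes s t := exists s' i,
  [/\ s = rcons s' i, apart s' t & [:: i] ∙ t = 1].

(** The +1 edge of a positive cycle joins the last letters of two chains that
    are otherwise apart; both chains start at a common block. *)
Definition crosses s t := exists s' i t' j,
  [/\ s = rcons s' i, t = rcons t' j, [:: i] ∙ [:: j] = 1,
      {in s' & t, forall k l, [:: k] ∙ [:: l] = 0}
    & {in t', forall l, [:: i] ∙ [:: l] = 0}].

Lemma apart_bw s t : apart s t -> s ∙ t = 0.
Proof.
elim: s => [|i s IHs] /=; first by rewrite bw_nill.
by case/andP=> /eqP it /IHs st; rewrite bw_consl it st.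
Qed.

Lemma attached_bw s t : attached s t -> s ∙ t = -1.
Proof.
by case: s => //= i s /andP[/eqP it /apart_bw st]; rewrite bw_consl it st.
Qed.

Lemma apartC s i : apart s [:: i] -> [:: i] ∙ s = 0.
Proof. by move/apart_bw; rewrite bwC. Qed.

Lemma closes_suffix s r t : closes (s ++ r) t -> r != [::] ->
  apart s t /\ r ∙ t = 1.
Proof.
case: (lastP r) => // r' k [s' [i [+ s't it] _]].
rewrite -rcons_cat => /rcons_inj[Ds' Dk]; move: s't; rewrite -Ds' /apart all_cat.
by case/andP=> st /apart_bw r't; rewrite Dk -cats1 bw_catl r't it.
Qed.

Lemma closes_bw s t : closes s t -> s ∙ t = 1.
Proof.
by move=> st; have := @closes_suffix [::] s t st; case: s st => [[[|? ?] [? []]]|? ? ? []].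
Qed.

Lemma closes_cons l s t : closes s t -> [:: l] ∙ t = 0 -> closes (l :: s) t.
Proof.
by case=> s' [i [-> s't it]] lt; exists (l :: s'), i; split; rewrite //= lt.
Qed.

Lemma apart_of_suffixes s t :
  (forall u r, s = u ++ r -> r ∙ t = 0) -> apart s t.
Proof.
elim: s => //= i s IHs st; rewrite IHs => [|u r su]; last first.
  by apply: (st (i :: u)); rewrite su.
have := st [::] _ erefl; rewrite bw_consl (st [:: i] s) // addr0 => ->.
by rewrite eqxx.
Qed.

Lemma closes_of_suffixes s t : s != [::] ->
  (forall u r, s = u ++ r -> r != [::] -> r ∙ t = 1) -> closes s t.
Proof.
elim: s => //= i s IHs _ st; have [s0|s0] := eqVneq s [::].
  by exists [::], i; split; rewrite ?s0 // (st [::] [:: i]) ?s0.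
apply: closes_cons.
  by apply: IHs => // u r su; apply: (st (i :: u)); rewrite su.
by have := st [::] _ erefl isT; rewrite bw_consl (st [:: i] s) //; lia.
Qed.

Lemma crossesC s t : crosses s t -> crosses t s.
Proof.
case=> s' [i [t' [j [Ds Dt ij s't it']]]]; exists t', j, s', i; split=> //.
- by rewrite bwC.
- move=> l k lt'; rewrite Ds mem_rcons inE bwC => /predU1P[->|ks']; first exact: it'.
  by apply: s't; rewrite // Dt mem_rcons inE lt' orbT.
- by move=> k ks'; rewrite bwC; apply: s't; rewrite // Dt mem_rcons mem_head.
Qed.

Lemma zero_bwr u t : {in t, forall l, u ∙ [:: l] = 0} -> u ∙ t = 0.
Proof.
move=> ut; rewrite bwC; apply: apart_bw; apply/allP => l /ut.
by rewrite bwC => ->.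
Qed.

Lemma crosses_closes s t : crosses s t -> closes s t.
Proof.
case=> s' [i [t' [j [Ds Dt ij s't it']]]]; exists s', i; split=> //.
  by apply/allP => k ks'; apply/eqP/zero_bwr => l; apply: s't.
by rewrite Dt -cats1 bw_catr ij (zero_bwr it').
Qed.

Lemma closes_crosses s l : closes s [:: l] -> crosses s [:: l].
Proof.
case=> s' [i [Ds s'l il]]; exists s', i, [::], l; split=> // k m ks'.
by rewrite inE => /eqP->; apply/eqP/(allP s'l).
Qed.

Lemma crosses_cons l s t : crosses s t -> apart t [:: l] -> crosses (l :: s) t.
Proof.
case=> s' [i [t' [j [Ds Dt ij s't it']]]] tl; exists (l :: s'), i, t', j.
split=> //; first by rewrite Ds.
move=> k m; rewrite inE => /predU1P[->|]; last exact: s't.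
by move=> /(allP tl); rewrite bwC => /eqP.
Qed.

Lemma crosses_neq s t : crosses s t -> {in s & t, forall k l, k != l}.
Proof.
case=> s' [i [t' [j [Ds Dt ij s't it']]]] k l ks lt; apply/eqP => kl.
have kl2 : [:: k] ∙ [:: l] = 2 by rewrite kl bw_diag qw1.
suff : [:: k] ∙ [:: l] \in [:: 0; 1] by rewrite kl2.
move: ks; rewrite Ds mem_rcons inE => /predU1P[->|ks']; last by rewrite s't.
move: lt; rewrite Dt mem_rcons inE => /predU1P[->|lt']; first by rewrite ij.
by rewrite it'.
Qed.

Lemma attached_catl s t u : attached (s ++ t) u -> s != [::] ->
  attached s u /\ apart t u.
Proof.
by case: s => //= i s /andP[-> +] _; rewrite /apart all_cat => /andP[-> ->].
Qed.

(** Without a chord from l to the tail of p, the head of p sees exactly one of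
    l and s. *)
Lemma attached_split p l s : attached p (l :: s) ->
  (forall t r, p = t ++ r -> t != [::] -> r ∙ [:: l] = 0) ->
  (p ∙ [:: l] = -1 -> attached p [:: l] /\ apart p s) /\
  (p ∙ [:: l] = 0 -> apart p [:: l] /\ attached p s).
Proof.
case: p => //= i p /andP[/eqP ils p_ls] cut.
have p_l : apart p [:: l].
  by apply: apart_of_suffixes => t r pE; apply: (cut (i :: t)); rewrite ?pE.
have p_s : apart p s.
  apply/allP => k kp; have := allP p_ls k kp; rewrite bw_consr.
  by have /eqP -> := allP p_l k kp; rewrite add0r.
rewrite bw_consl (apart_bw p_l) addr0 p_l p_s; rewrite bw_consr in ils.
by split=> il; rewrite il in ils *; split=> //; rewrite ?andbT; apply/eqP; lia.
Qed.

Lemma chain_catl s t : chain (s ++ t) -> chain s.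
Proof.
elim: s => //= i s IHs /andP[his /IHs->]; rewrite andbT.
case: s {IHs} his => //= k s /andP[->]; rewrite /apart all_cat.
by case/andP.
Qed.

Lemma chain_catr s t : chain (s ++ t) -> chain t.
Proof. by elim: s => //= i s IHs /andP[_]. Qed.

(** Only the edge between the two parts of the chain contributes. *)
Lemma chain_cut s t : chain (s ++ t) -> s != [::] -> t != [::] -> s ∙ t = -1.
Proof.
elim: s => //= i s IHs /andP[his cst] _ t0; rewrite bw_consl.
have [s0|s0] := eqVneq s [::].
  rewrite s0 bw_nill addr0 bwC; move: his; rewrite s0 /=.
  by case: t t0 {cst IHs} => // k t _; apply: attached_bw.
rewrite (IHs cst s0 t0); move: his.
case: s s0 {IHs cst} => // k s _; rewrite [nilp _]/= => /attached_catl[] // _.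
by move/apartC->.
Qed.

(** A tree with k vertices has k - 1 edges, each contributing -1. *)
Lemma chain_qw s : chain s -> s != [::] -> qw a s = 1.
Proof.
elim: s => //= i s IHs /andP[his cs] _; have [->|s0] := eqVneq s [::].
  by rewrite qw1.
rewrite qw_cons IHs // bwC.
by case: s s0 his {IHs cs} => // k s _ /attached_bw->.
Qed.

Lemma chain_cons l s : chain s -> attached s [:: l] -> chain (l :: s).
Proof. by move=> /= -> ->; rewrite orbT. Qed.

(** [catrev s (k :: t)] moves the letters of s, starting with its head, one by
    one in front of k; this is how two chains with a common start are glued. *)
Lemma chain_catrev s k t : chain s -> chain (k :: t) -> attached s [:: k] ->
  {in s & t, forall i j, [:: i] ∙ [:: j] = 0} -> chain (catrev s (k :: t)).
Proof.
elim: s k t => //= i s IHs k t /andP[his cs] ckt /andP[/eqP ik sk] st.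
have [->|s0] := eqVneq s [::].
  apply: chain_cons; rewrite //= bwC ik eqxx /=.
  by apply/allP => j jt; rewrite bwC st ?mem_head.
have {his} si : attached s [:: i] by case: s s0 his {IHs cs sk st}.
apply: IHs => //.
  apply: chain_cons; rewrite //= bwC ik eqxx /=.
  by apply/allP => j jt; rewrite bwC st ?mem_head.
move=> x j xs; rewrite inE => /predU1P[->|jt]; first exact/eqP/(allP sk).
by rewrite st // inE xs orbT.
Qed.

Lemma chain_nth x0 s (i j : nat) : chain s -> (i < j < size s)%N ->
  [:: nth x0 s i] ∙ [:: nth x0 s j] = if j == i.+1 then -1 else 0.
Proof.
elim: s i j => [|x s IHs] i j; first by rewrite ltn0 andbF.
case: j => // j /= /andP[hxs cs]; rewrite !ltnS => ij.
case: i ij => [|i] ij /=; last by rewrite IHs.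
case: s hxs ij {IHs cs} => //= y s /andP[/eqP yx sx]; case: j => [|j] /= js.
  by rewrite bwC.
by rewrite bwC; apply/eqP/(allP sx)/mem_nth.
Qed.

Lemma dvdz_le (m d : int) : `|d| <= m -> (m %| d)%Z = (d == 0) || (`|d| == m).
Proof.
move=> dm; apply/idP/orP => [|[/eqP->|/eqP <-]]; last 2 first.
- exact: dvdz0.
- by rewrite dvdzE absz_id.
have [|d0] := eqVneq d 0; first by left.
by rewrite dvdzE => /dvdn_leq; rewrite absz_gt0 => /(_ d0) md; right; lia.
Qed.

Lemma cyclic_neighboursE (m i j : nat) : (i < m)%N -> (j < m)%N -> (3 <= m)%N ->
  cyclic_neighbours m i j =
  [|| j == i.+1, i == j.+1 | are_endpoints m i j].
Proof.
move=> im jm m3; rewrite /cyclic_neighbours /are_endpoints !eqz_mod_dvd.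
rewrite !dvdz_le; [|lia..].
lia.
Qed.

(** Removing either end of a positive chordless cycle leaves a chordless chain,
    and these two chains together with the +1 edge describe the cycle. *)
Lemma chains_positive_cycle i s j :
  s != [::] -> chain (i :: s) -> chain (rcons s j) -> [:: i] ∙ [:: j] = 1 ->
  positive_chordless_cycle (unit_form a) (in_tuple (i :: rcons s j)).
Proof.
move=> s0 cis csj ij; set c := i :: rcons s j.
have c3 : (3 <= size c)%N by rewrite /= size_rcons; case: (s) s0.
have cE (x y : 'I_(size c)) : bform (unit_form a)
    (ebasis (tnth (in_tuple c) x)) (ebasis (tnth (in_tuple c) y))
    = [:: nth i c x] ∙ [:: nth i c y].
  by rewrite !(tnth_nth i) /bw !weight1.
have cnth x y : (x < y < size c)%N -> [:: nth i c x] ∙ [:: nth i c y] =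
    if (x == 0)%N && (y == (size c).-1) then 1
    else if y == x.+1 then -1 else 0.
  move=> /andP[xy yc]; have [yl|yl] := eqVneq y (size c).-1.
    rewrite andbT; case: x xy => [_|x xy].
      by rewrite yl /c /= size_rcons /= nth_rcons ltnn eqxx ij.
    case: y xy yc {yl} => // y xy yc.
    by apply: (chain_nth i csj); apply/andP.
  have ys : (y < size (i :: s))%N by move: yc yl; rewrite /c /= size_rcons; lia.
  rewrite andbF -(chain_nth i cis) ?xy //.
  have cis_c z : (z < size (i :: s))%N -> nth i c z = nth i (i :: s) z.
    by move=> zs; rewrite /c -rcons_cons nth_rcons zs.
  by rewrite !cis_c // (ltn_trans xy).
have cnthC x y : (x < size c)%N -> (y < size c)%N -> x != y ->
    [:: nth i c x] ∙ [:: nth i c y] =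
    if are_endpoints (size c) x y then 1
    else if (y == x.+1) || (x == y.+1) then -1 else 0.
  move=> xc yc; rewrite neq_ltn /are_endpoints => /orP[xy|yx].
    rewrite cnth ?xy //.
    have -> : (x == (size c).-1) = false by lia.
    have -> : (x == y.+1) = false by lia.
    by rewrite /= !orbF.
  rewrite bwC cnth ?yx //.
  have -> : (y == (size c).-1) = false by lia.
  have -> : (y == x.+1) = false by lia.
  by rewrite andbF andbC.
split; first split=> //.
- apply/(uniqP i) => x y xc yc xy; apply/eqP/negP => /negP nxy.
  have := cnthC x y xc yc nxy; rewrite xy bw_diag qw1.
  by case: ifP => // _; case: ifP.
- move=> x y nxy; rewrite cE cnthC // cyclic_neighboursE //.
  case: are_endpoints; rewrite ?orbT ?orbF; first by split.
  by case: (_ || _); split.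
- move=> x y x0 yl; rewrite cE x0 yl cnth //; first by rewrite !eqxx.
  by rewrite /c /= size_rcons; lia.
- move=> x y nxy; rewrite cE cyclic_neighboursE // (negPf nxy) orbF => nb.
  rewrite cnthC // ?(negPf nxy) ?nb //.
  by apply/eqP => xy; move: nb; rewrite xy; lia.
Qed.

Lemma chain_of_nth x0 s : (forall i j : nat, (i < j < size s)%N ->
  [:: nth x0 s i] ∙ [:: nth x0 s j] = if j == i.+1 then -1 else 0) -> chain s.
Proof.
elim: s => //= x s IHs s_nth; apply/andP; split; last first.
  by apply: IHs => i j ij; have := s_nth i.+1 j.+1 ij.
case: s s_nth {IHs} => //= y s s_nth.
rewrite bwC (s_nth 0%N 1%N) //=; apply/(all_nthP x0) => k ks.
by rewrite bwC (s_nth 0%N k.+2).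
Qed.

Lemma positive_cycle_chains m (c : m.-tuple 'I_n) :
  positive_chordless_cycle (unit_form a) c ->
  exists i s j, [/\ s != [::], tval c = i :: rcons s j, chain (i :: s),
    chain (rcons s j) & [:: i] ∙ [:: j] = 1].
Proof.
case=> -[m3 _ c_nb] c_ends c_path.
have [i [s [j cE]]] : exists i s j, tval c = i :: rcons s j.
  have := size_tuple c; case: (tval c) => [|i t]; first by move: m3 => /[swap] <-.
  case: (lastP t) => [|s j]; first by move: m3 => /[swap] <-.
  by exists i, s, j.
have mE : m = (size s).+2 by rewrite -(size_tuple c) cE /= size_rcons.
have cn (x y : 'I_m) : bform (unit_form a) (ebasis (tnth c x)) (ebasis (tnth c y))
    = [:: nth i (i :: rcons s j) x] ∙ [:: nth i (i :: rcons s j) y].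
  by rewrite !(tnth_nth i) /bw !weight1 cE.
have ci (x y : nat) : (x < y < m)%N -> (0 < x)%N || (y < m.-1)%N ->
    [:: nth i (i :: rcons s j) x] ∙ [:: nth i (i :: rcons s j) y]
    = if y == x.+1 then -1 else 0.
  move=> /andP[xy ym] inner; have xm := ltn_trans xy ym.
  have nends : ~~ are_endpoints m x y by rewrite /are_endpoints; lia.
  have := cn (Ordinal xm) (Ordinal ym) => /= <-.
  have nb := cyclic_neighboursE xm ym m3; rewrite (negPf nends) orbF in nb.
  case: eqP => yx; first by apply: c_path => //=; rewrite nb yx eqxx.
  apply/eqP; apply: contraT => c0.
  have : cyclic_neighbours m x y.
    by apply/(c_nb (Ordinal xm) (Ordinal ym)); rewrite // -val_eqE /= neq_ltn xy.
  by rewrite nb; lia.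
have s0 : s != [::] by case: (s) mE m3 => // ->.
exists i, s, j; split=> //.
- apply: (@chain_of_nth i (i :: s)) => x y /andP[xy ys].
  have nE z : (z <= size s)%N -> nth i (i :: s) z = nth i (i :: rcons s j) z.
    by move=> zs; rewrite -rcons_cons nth_rcons /= ltnS zs.
  rewrite /= ltnS in ys; rewrite !nE; [by apply: ci; lia | lia..].
- apply: (@chain_of_nth i (rcons s j)) => x y; rewrite size_rcons => /andP[xy ys].
  have := @ci x.+1 y.+1; rewrite /= eqSS; apply; lia.
- have m0 : (0 < m)%N by rewrite mE.
  have m1 : (m.-1 < m)%N by rewrite mE.
  have := c_ends (Ordinal m0) (Ordinal m1) erefl erefl.
  by rewrite cn /= mE /= nth_rcons ltnn eqxx.
Qed.

End Chains.

(** * Vanishing of the monomials that are not roots *)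

(** [lia] splits on every boolean hypothesis that it cannot interpret; dropping
    the combinatorial ones first keeps it fast. *)
Ltac word_lia :=
  repeat match goal with
  | H : is_true (chain _ _) |- _ => clear H
  | H : is_true (attached _ _ _) |- _ => clear H
  | H : is_true (apart _ _ _) |- _ => clear H
  | H : is_true (perm_eq _ _) |- _ => clear H
  | H : is_true (~~ (_ == [::])) |- _ => clear H
  | H : _ -> _ |- _ => clear H
  end; lia.

Section Reduction.
Variables (K : fieldType) (L : lieAlgType K).
Variables (n : nat) (a : 'I_n -> 'I_n -> int) (v : 'I_n -> L).
Implicit Types (i j k l : 'I_n) (p q r s t u : seq 'I_n) (x y z w : L).
Local Notation "s ∙ t" := (bw a s t) (at level 40).
Local Notation qw := (qw a).

Hypothesis q_posdef : positive_definite (unit_form a).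
Hypothesis two_neq0 : 2 != 0 :> K.
Hypothesis v_comm : forall i j, [:: i] ∙ [:: j] != -1 -> ⁅v i, v j⁆ = 0.
Hypothesis v_serre :
  forall i j, [:: i] ∙ [:: j] = -1 -> ⁅v i, ⁅v i, v j⁆⁆ = 0.
Hypothesis v_cycle : forall m (c : m.-tuple 'I_n),
  positive_chordless_cycle (unit_form a) c -> multibracket (map v c) = 0.

Definition br s : L := multibracket (map v s).

Lemma br_cons i s : s != [::] -> br (i :: s) = ⁅v i, br s⁆.
Proof. by case: s. Qed.

(** The word attached to a monomial records its degree. *)
Inductive monomial : seq 'I_n -> L -> Prop :=
| monomial_gen i : monomial [:: i] (v i)
| monomial_lie s t x y :
    monomial s x -> monomial t y -> monomial (s ++ t) ⁅x, y⁆.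

Lemma monomial_br s : s != [::] -> monomial s (br s).
Proof.
elim: s => // i s IHs _; have [->|s0] := eqVneq s [::]; first exact: monomial_gen.
rewrite br_cons // -cat1s; apply: monomial_lie (monomial_gen i) (IHs s0).
Qed.

Lemma monomial_neq0 s x : monomial s x -> s != [::].
Proof.
by elim=> // s1 s2 x1 x2 _ + _ _; case: s1.
Qed.

Lemma monomial_size s x : monomial s x -> (0 < size s)%N.
Proof. by move/monomial_neq0; case: s. Qed.

(** Membership in the additive group generated by the multibrackets of the
    rearrangements of s, expressed by an elimination principle. *)
Definition br_span s x := forall Z : L -> Prop, Z 0 ->
  (forall y z, Z y -> Z z -> Z (y - z)) ->
  (forall t, perm_eq t s -> Z (br t)) -> Z x.

Lemma br_span_sub s x y : br_span s x -> br_span s y -> br_span s (x - y).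
Proof. by move=> sx sy Z Z0 ZB Zs; exact: ZB (sx Z Z0 ZB Zs) (sy Z Z0 ZB Zs). Qed.

Lemma br_span_perm s t x : perm_eq s t -> br_span s x -> br_span t x.
Proof.
by move=> st sx Z Z0 ZB Zt; apply: sx => // u us; apply/Zt/(perm_trans us).
Qed.

(** The Jacobi identity [[x1, x2], y] = [x1, [x2, y]] - [x2, [x1, y]] turns
    left-nested brackets into standard ones. *)
Lemma br_span_lie s x t y : monomial s x -> t != [::] -> br_span t y ->
  br_span (s ++ t) ⁅x, y⁆.
Proof.
move=> mx; elim: mx t y => {s x} [i|s1 s2 x1 x2 m1 IH1 m2 IH2] t y t0 ty.
  move=> Z Z0 ZB Zt; apply: (ty (fun y => Z ⁅v i, y⁆)) => [|y1 y2 Z1 Z2|u ut].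
  - by rewrite lie0r.
  - by rewrite lieDr lieNr; apply: ZB.
  - rewrite -br_cons; first by apply: Zt; rewrite perm_cons.
    by apply: contra t0 => /eqP u0; move: ut; rewrite u0 perm_sym => /perm_nilP/eqP.
have nt s : s ++ t != [::] by case: s => [|i s]; rewrite //= t0.
rewrite lie_lieE -catA; apply: br_span_sub; first exact: IH1 (nt _) (IH2 _ _ t0 ty).
apply: br_span_perm (IH2 _ _ (nt _) (IH1 _ _ t0 ty)).
by rewrite perm_catCA.
Qed.

Lemma monomial_span s x : monomial s x -> br_span s x.
Proof.
elim=> {s x} [i Z _ _ Zi|s t x y mx _ my sy]; first exact: (Zi [:: i]).
exact: br_span_lie mx (monomial_neq0 my) sy.
Qed.

(** The induction step on the degree: h is the length of the words under
    consideration, and the claim is known for shorter ones. *)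
Section Step.
Variable h : nat.
Hypothesis IH : forall s x,
  monomial s x -> (size s < h)%N -> qw s != 1 -> x = 0.

Lemma monomial_comm s t x y : monomial s x -> monomial t y ->
  (size s + size t < h)%N -> s ∙ t != -1 -> ⁅x, y⁆ = 0.
Proof.
move=> mx my sth st.
have [qs|qs] := eqVneq (qw s) 1; last by rewrite (IH mx) ?lie0l //; word_lia.
have [qt|qt] := eqVneq (qw t) 1; last by rewrite (IH my) ?lie0r //; word_lia.
by apply: (IH (monomial_lie mx my)); rewrite ?size_cat // qw_cat; word_lia.
Qed.

(** The case of a chain y - x - z in type A3, where twice x plus y plus z is not
    a root: expanding [x, [x, [y, z]]] = 0 yields 2 [[x, y], [x, z]] = 0. *)
Lemma serre_middle r s t x y z :
  monomial r x -> monomial s y -> monomial t z ->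
  (size r + size r + size s + size t <= h)%N ->
  r ∙ s = -1 -> r ∙ t = -1 -> s ∙ t != -1 -> ⁅⁅x, y⁆, ⁅x, z⁆⁆ = 0.
Proof.
move=> mx my mz rsth rs rt st.
have r0 := qw_gt0 q_posdef (monomial_neq0 mx).
have [[r1 s0] t0] := (monomial_size mx, monomial_size my, monomial_size mz).
have xxy : ⁅x, ⁅x, y⁆⁆ = 0.
  by apply: (monomial_comm mx (monomial_lie mx my)); rewrite ?size_cat ?bw_catr ?bw_diag; word_lia.
have xxz : ⁅x, ⁅x, z⁆⁆ = 0.
  by apply: (monomial_comm mx (monomial_lie mx mz)); rewrite ?size_cat ?bw_catr ?bw_diag; word_lia.
have yz : ⁅y, z⁆ = 0 by apply: (monomial_comm my mz); word_lia.
have : ⁅x, ⁅x, ⁅y, z⁆⁆⁆ = 0 by rewrite yz !lie0r.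
rewrite (lie_der x y z) lieDr (lie_der x ⁅x, y⁆) xxy lie0l add0r.
rewrite (lie_der x y) xxz lie0r addr0 -mulr2n -scaler_nat => /eqP.
by rewrite scaler_eq0 (negPf two_neq0) => /eqP.
Qed.

(** Here [x, y] is a chain cut in two, [z, z'] a composite block whose half z is
    attached to x, and y a part of the chain with a chord to z.  The chord has
    sign +1, since three blocks with pairwise products -1 are dependent.  If the
    block w, which closes the cycle at y, is attached to z', everything
    regroups into commuting shorter brackets; if it is attached to z, then y has
    product 2 with the root z + w, hence the same weight, which the
    disjointness of the letters of y and w forbids. *)
Lemma chord_zero p r s t u x y z z' w :
  monomial p x -> monomial r y -> monomial s z -> monomial t z' ->
  monomial u w ->
  (size p + size r + size s + size t + size u <= h)%N ->
  qw p = 1 -> qw r = 1 -> qw s = 1 -> qw t = 1 -> qw u = 1 ->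
  p ∙ r = -1 -> p ∙ s = -1 -> p ∙ t = 0 -> p ∙ u = 0 ->
  r ∙ s != 0 -> r ∙ t = - (r ∙ s) -> r ∙ u = 1 ->
  s ∙ t = -1 -> s ∙ u + t ∙ u = -1 -> {in r & u, forall i j, i != j} ->
  ⁅⁅x, y⁆, ⁅⁅z, z'⁆, w⁆⁆ = 0.
Proof.
move=> mp mr ms mt mu hs qp qr qs qt qu pr ps pt pu rs rt ru st stu ru_disj.
have [p0 r0] := (monomial_size mp, monomial_size mr).
have [[s0 t0] u0] := (monomial_size ms, monomial_size mt, monomial_size mu).
(* If this product were -1, the form would vanish on p ++ r ++ s. *)
have rs1 : r ∙ s = 1.
  have r_s := bw_ge q_posdef (monomial_neq0 mr) qr qs.
  have r_t := bw_ge q_posdef (monomial_neq0 mr) qr qt.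
  have : 0 < qw (p ++ r ++ s).
    by apply: qw_gt0 => //; case: (p) p0.
  by rewrite !qw_cat bw_catr; word_lia.
have s_u := bw_ge q_posdef (monomial_neq0 ms) qs qu.
have t_u := bw_ge q_posdef (monomial_neq0 mt) qt qu.
have [su|su] : s ∙ u = 0 \/ s ∙ u = -1 by word_lia.
  have zw : ⁅z, w⁆ = 0 by apply: (monomial_comm ms mu); word_lia.
  have xz'w : ⁅x, ⁅z', w⁆⁆ = 0.
    by apply: (monomial_comm mp (monomial_lie mt mu)); rewrite ?size_cat ?bw_catr; word_lia.
  have yz : ⁅y, z⁆ = 0 by apply: (monomial_comm mr ms); word_lia.
  have yz'w : ⁅y, ⁅z', w⁆⁆ = 0.
    by apply: (monomial_comm mr (monomial_lie mt mu)); rewrite ?size_cat ?bw_catr; word_lia.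
  have yxz : ⁅y, ⁅x, z⁆⁆ = 0.
    apply: (monomial_comm mr (monomial_lie mp ms)); rewrite ?size_cat ?bw_catr; first word_lia.
    by rewrite (bwC _ r p) pr rs1.
  rewrite (lie_lieE z) zw lie0r subr0 lie_lieE (lie_centr yz yz'w) lie0r.
  by rewrite (lie_push _ xz'w) (lie_centr yxz yz'w) subr0.
have /allP : perm_eq r (s ++ u).
  apply: (bw_eq q_posdef); rewrite bw_catr qw_cat qr qs qu su rs1 ru; word_lia.
have [j ju] : exists j, j \in u.
  by case: (u) u0 => // j u' _; exists j; rewrite mem_head.
move=> /(_ j); rewrite !mem_cat ju !orbT => /(_ isT) /=.
have -> : count_mem j r = 0%N.
  by apply/count_memPn/negP => jr; have := ru_disj j j jr ju; rewrite eqxx.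
by rewrite count_cat eq_sym addn_eq0 => /andP[_ /eqP/count_memPn]; rewrite ju.
Qed.

(** A letter commutes with every part of the chain beyond its neighbour, so
    the bracket of a chain does not depend on how it is bracketed. *)
Lemma br_cat s t : chain a (s ++ t) -> s != [::] -> t != [::] ->
  (size s + size t <= h)%N -> br (s ++ t) = ⁅br s, br t⁆.
Proof.
elim: s => // i s IHs cst _ t0 sth.
have [->|s0] := eqVneq s [::]; first by rewrite cat1s br_cons.
have st0 : s ++ t != [::] by case: (s) s0.
rewrite cat_cons !br_cons // IHs //; last 2 first.
- by case/andP: cst.
- by move: sth => /=; word_lia.
apply: lie_push; apply: (monomial_comm (monomial_gen i) (monomial_br t0)).
  by have := monomial_size (monomial_br s0); move: sth => /=; word_lia.
have := chain_cut (s := i :: s) cst isT t0.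
rewrite bw_consl (chain_cut (s := s)) //; last by case/andP: cst.
by move=> ?; word_lia.
Qed.

(** Weight spaces along a chain have dimension at most 1: a letter whose removal
    from a chain leaves a root must be one of its two ends. *)
Lemma br_perm_chain s t : chain a t -> perm_eq s t -> (size t <= h)%N ->
  exists c, br s = c *: br t.
Proof.
have [m] := ubnP (size t); elim: m s t => // m IHm s t + ct st th.
case: s st => [|i s] st.
  by move: st; rewrite perm_sym => /perm_nilP->; exists 1; rewrite scale1r.
rewrite ltnS => tm.
have [s0|s0] := eqVneq s [::].
  by exists 1; rewrite scale1r; apply: congr1; apply: perm_small_eq; rewrite // -(perm_size st) s0.
have sts := perm_size st; rewrite /= in sts.
have [qs|qs] := eqVneq (qw s) 1; last first.
  exists 0; rewrite scale0r br_cons //.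
  by rewrite (IH (monomial_br s0)) ?lie0r //; word_lia.
have t0 : t != [::] by case: (t) sts.
have is1 : [:: i] ∙ s = -1.
  by have := qw_perm a st; rewrite qw_cons qs (chain_qw ct t0); word_lia.
have it1 : [:: i] ∙ t = 1.
  by rewrite -(bw_permr _ _ st) bw_consr bw_diag qw1 is1.
have [t1 [t2 Dt]] : exists t1 t2 : seq 'I_n, t = t1 ++ i :: t2.
  have : i \in t by rewrite -(perm_mem st) mem_head.
  by case/splitPr => t1 t2; exists t1, t2.
move: it1; rewrite {}Dt in ct st th tm sts {t0} *.
have {}st : perm_eq s (t1 ++ t2).
  by rewrite -(perm_cons i); apply: perm_trans st _; rewrite -cat_rcons -cats1 -catA perm_catCA.
rewrite size_cat /= in th tm sts.
have [t10|t10] := eqVneq t1 [::].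
  move: st ct; rewrite t10 /= => st /andP[_ ct2] _.
  have [t2m t2h] : (size t2 < m)%N /\ (size t2 <= h)%N by word_lia.
  have [c br_s] := IHm _ _ t2m ct2 st t2h.
  exists c; rewrite !br_cons // ?br_s ?lieZr //.
  by apply: contra s0 => /eqP t20; move: st; rewrite t20 => /perm_nilP->.
rewrite bw_catr bw_consr bw_diag qw1 (bwC a _ t1).
have ct1i : chain a (t1 ++ [:: i]) by apply: (chain_catl (t := t2)); rewrite -catA.
rewrite (chain_cut ct1i) //; have [t20 _|t20] := eqVneq t2 [::]; last first.
  by rewrite (chain_cut (chain_catr ct : chain a ([:: i] ++ t2))).
move: st; rewrite t20 cats0 => st; rewrite t20 addn1 /= in th tm sts.
have [t1m t1h] : (size t1 < m)%N /\ (size t1 <= h)%N by word_lia.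
have [c br_s] := IHm _ _ t1m (chain_catl ct1i) st t1h.
case: t1 {ct} t10 ct1i st th tm sts t1m t1h br_s => // k t1 _ ct1i st /= th tm sts t1m t1h.
have [->|t10] := eqVneq t1 [::] => br_s; rewrite br_cons // br_s lieZr.
  by exists (- c); rewrite scaleNr lieC scalerN.
have ki : [:: i] ∙ [:: k] = 0.
  have t1i0 : t1 ++ [:: i] != [::] by case: (t1).
  have := chain_cut (ct1i : chain a ([:: k] ++ (t1 ++ [:: i]))) isT t1i0.
  have := chain_cut (chain_catl ct1i : chain a ([:: k] ++ t1)) isT t10.
  by rewrite bw_catr (bwC _ [:: i]) => ->; word_lia.
have [||||c' br_t1] := IHm (i :: t1) (t1 ++ [:: i]).
- by rewrite size_cat addn1.
- by case/andP: ct1i.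
- by rewrite -cat1s perm_catC.
- by rewrite size_cat addn1.
exists (c * c'); rewrite br_cons // lie_swap; last by apply: v_comm; rewrite ki.
rewrite -(br_cons i) // br_t1 lieZr scalerA -br_cons //.
by case: (t1).
Qed.

Lemma positive_cycle_zero i s j : s != [::] -> chain a (i :: s) ->
  chain a (rcons s j) -> [:: i] ∙ [:: j] = 1 -> br (i :: rcons s j) = 0.
Proof.
by move=> s0 cis csj ij; apply: (v_cycle (chains_positive_cycle s0 cis csj ij)).
Qed.

(** Two chains starting at adjacent letters form one long chain; the tail of p
    commutes with s because of the +1 edge, so the letters of p can be moved to
    s one at a time. *)
Lemma bracket_catrev p s : chain a p -> p != [::] -> s != [::] ->
  (size p + size s <= h)%N ->
  (forall t r, p = t ++ r -> t != [::] -> r != [::] -> r ∙ s = 1) ->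
  br (catrev p s) = 0 -> ⁅br p, br s⁆ = 0.
Proof.
elim: p s => // i p IHp s cip _ s0 hs cut; have [->|p0] := eqVneq p [::].
  by rewrite /= br_cons.
rewrite /= => br0; rewrite br_cons // lie_lieE.
have ps : p ∙ s = 1 by apply: (cut [:: i]).
have [s1 p1] := (monomial_size (monomial_br s0), monomial_size (monomial_br p0)).
rewrite (monomial_comm (monomial_br p0) (monomial_br s0)) ?ps //.
rewrite lie0r sub0r -br_cons // IHp ?oppr0 //.
- by case/andP: cip.
- by move: hs => /=; word_lia.
move=> t r pE t0 r0; rewrite bw_consr (cut (i :: t)) ?pE //.
have : attached a p [:: i] by case: (p) p0 cip => // ? ? _ /andP[].
by rewrite pE => /attached_catl[] // _ /apart_bw->.
Qed.

(** The end of the refinement: the block is a single letter k, and p, k, q is a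
    positive chordless cycle. *)
Lemma two_chain_cycle_zero p k q : chain a p -> chain a q ->
  p != [::] -> q != [::] -> attached a p [:: k] -> attached a q [:: k] ->
  crosses a p q -> (size p + size q < h)%N ->
  ⁅br p, ⁅v k, br q⁆⁆ = 0.
Proof.
move=> cp cq p0 q0 pk qk pq hs; rewrite -br_cons //.
apply: bracket_catrev => //; first by move: hs => /=; word_lia.
  move=> t r pE t0 r0; move: (crosses_closes pq) pk; rewrite bw_consr pE.
  by move=> /closes_suffix-/(_ r0)[_ ->] /attached_catl-/(_ t0)[_ /apart_bw->].
case: pq => p' [i [q' [j [Dp Dq ij p'q iq']]]].
have -> : catrev p (k :: q) = i :: rcons (catrev p' (k :: q')) j.
  by rewrite Dp Dq !catrevE rev_rcons /= -rcons_cons -rcons_cat.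
have pq' : {in p & q', forall i1 j1, [:: i1] ∙ [:: j1] = 0}.
  move=> i1 j1; rewrite Dp mem_rcons inE => /predU1P[->|ip'] jq'; first exact: iq'.
  by apply: p'q; rewrite // Dq mem_rcons inE jq' orbT.
have ckq := chain_cons cq qk.
apply: positive_cycle_zero => //.
- by rewrite catrevE; case: (rev p').
- have -> : i :: catrev p' (k :: q') = catrev p (k :: q').
    by rewrite Dp !catrevE rev_rcons.
  apply: chain_catrev => //; apply: (chain_catl (t := [:: j])).
  by rewrite cat_cons cats1 -Dq.
- have -> : rcons (catrev p' (k :: q')) j = catrev p' (k :: q).
    by rewrite !catrevE Dq -rcons_cons -rcons_cat.
  have [->//|p'0] := eqVneq p' [::].
  move: cp pk; rewrite Dp -cats1 => /chain_catl cp' /attached_catl-/(_ p'0)[p'k _].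
  exact: chain_catrev.
Qed.

Lemma closing_chain_zero i p k : chain a (i :: p) -> p != [::] ->
  [:: i] ∙ [:: k] = -1 -> closes a p [:: k] -> (size p + 1 < h)%N ->
  ⁅br (i :: p), v k⁆ = 0.
Proof.
move=> cip p0 ik pk hs; apply: (bracket_catrev (s := [:: k])) => //.
  by case=> // i' t r [<- pE] _ r0; move: pk; rewrite pE => /closes_suffix[].
have pi : attached a p [:: i] by case: (p) p0 cip => // ? ? _ /andP[].
case: pk => p' [j [Dp p'k jk]].
have -> : catrev (i :: p) [:: k] = j :: rcons (catrev p' [:: i]) k.
  by rewrite Dp !catrevE rev_cons rev_rcons /= -!cats1.
apply: positive_cycle_zero => //.
- by rewrite catrevE; case: (rev p').
- have -> : j :: catrev p' [:: i] = catrev p [:: i].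
    by rewrite Dp !catrevE rev_rcons.
  by apply: chain_catrev => //; case/andP: cip.
- have -> : rcons (catrev p' [:: i]) k = catrev (i :: p') [:: k].
    by rewrite !catrevE rev_cons -!cats1.
  apply: chain_catrev => //.
    by move: cip; rewrite Dp -cats1 -cat_cons => /chain_catl.
  by rewrite /= ik eqxx.
Qed.

(** A chord from l to a part r of the chain that does not contain its head makes
    the bracket vanish: [chord_zero] applies with l and s in an order that
    depends on which of the two is attached to the head. *)
Lemma chord_through_block p r q l s : chain a (p ++ r) -> chain a q ->
  crosses a (p ++ r) q -> attached a (p ++ r) (l :: s) ->
  attached a q (l :: s) -> p != [::] -> r != [::] -> q != [::] ->
  s != [::] -> qw s = 1 -> [:: l] ∙ s = -1 ->
  (size p + size r + size s + size q < h)%N -> r ∙ [:: l] != 0 ->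
  ⁅br (p ++ r), ⁅⁅v l, br s⁆, br q⁆⁆ = 0.
Proof.
move=> cpr cq pr_q pr_ls q_ls p0 r0 q0 s0 qs ls hs rl.
have [cp cr] := (chain_catl cpr, chain_catr cpr).
have [mp mr mq ms ml] : [/\ monomial p (br p), monomial r (br r),
    monomial q (br q), monomial s (br s) & monomial [:: l] (v l)].
  by split; try exact: monomial_br; apply: monomial_gen.
have [qp qr qq] : [/\ qw p = 1, qw r = 1 & qw q = 1].
  by split; apply: chain_qw.
have pr := chain_cut cpr p0 r0.
have rq : r ∙ q = 1 by have [] := closes_suffix (crosses_closes pr_q) r0.
have pq : p ∙ q = 0.
  by have := closes_bw (crosses_closes pr_q); rewrite bw_catl rq; word_lia.
have [/attached_bw pls /apart_bw rls] := attached_catl pr_ls p0.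
have qls := attached_bw q_ls.
rewrite bw_consr in pls; rewrite bw_consr in rls; rewrite bw_consr in qls.
have disj : {in r & q, forall i j, i != j}.
  by move=> i j ir; apply: (crosses_neq pr_q); rewrite mem_cat ir orbT.
have pl := bw_ge q_posdef p0 qp (qw1 a l).
have ps := bw_ge q_posdef p0 qp qs.
rewrite br_cat //; last word_lia.
have [pl1|pl0] : p ∙ [:: l] = -1 \/ p ∙ [:: l] = 0 by word_lia.
  apply: (chord_zero mp mr ml ms mq) => //; rewrite ?qw1 //; try word_lia.
    by move=> /=; word_lia.
  by rewrite (bwC _ _ q) (bwC _ s); word_lia.
rewrite (lieC (v l)) lieNl lieNr (chord_zero mp mr ms ml mq) ?oppr0 ?qw1 //; try word_lia.
- by move=> /=; word_lia.
- by rewrite bwC.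
- by rewrite (bwC _ s q) (bwC _ _ q); word_lia.
Qed.

(** The cycle p, s, q with a composite block s, refined by splitting off the
    first letter of s; it goes to the chain whose head it is attached to.  If it
    is attached to both heads or to none, shorter brackets commute. *)
Lemma two_chains_zero s p q : s != [::] -> chain a p -> chain a q ->
  p != [::] -> q != [::] -> attached a p s -> attached a q s ->
  crosses a p q -> (size p + size s + size q <= h)%N ->
  ⁅br p, ⁅br s, br q⁆⁆ = 0.
Proof.
elim: s p q => // l s IHs p q _ cp cq p0 q0 p_ls q_ls pq hs.
have [s0|s0] := eqVneq s [::].
  rewrite s0 in p_ls q_ls hs *; apply: two_chain_cycle_zero => //.
  by move: hs => /=; word_lia.
have [mp mq ms ml] : [/\ monomial p (br p), monomial q (br q),
    monomial s (br s) & monomial [:: l] (v l)].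
  by split; try exact: monomial_br; apply: monomial_gen.
have [[zp zq] zs] := (monomial_size mp, monomial_size mq, monomial_size ms).
rewrite /= in hs.
have pq1 := closes_bw (crosses_closes pq).
have pq_zero : ⁅br p, br q⁆ = 0 by apply: (monomial_comm mp mq); word_lia.
have swap : ⁅br p, ⁅br (l :: s), br q⁆⁆ = ⁅br q, ⁅br (l :: s), br p⁆⁆.
  by rewrite lie_push // lieC -lieNr -lieC.
have [|qls1] := eqVneq (qw (l :: s)) 1; last first.
  by rewrite (IH (monomial_br (isT : l :: s != [::]))) ?lie0l ?lie0r //=; word_lia.
have [qs|qs1] := eqVneq (qw s) 1; last first.
  by rewrite (br_cons _ s0) (IH ms) ?lie0r ?lie0l ?lie0r //; word_lia.
rewrite qw_cons qs => qls; have {qls} ls : [:: l] ∙ s = -1 by word_lia.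
have [//|W0] := eqVneq ⁅br p, ⁅br (l :: s), br q⁆⁆ 0.
have p_l t r : p = t ++ r -> t != [::] -> r ∙ [:: l] = 0.
  move=> pE t0; have [->|r0] := eqVneq r [::]; first exact: bw_nill.
  apply/eqP; apply: contraNT W0 => rl; apply/eqP.
  rewrite pE in cp pq p_ls *; rewrite (br_cons _ s0).
  apply: chord_through_block => //.
  by move: hs; rewrite pE size_cat; word_lia.
have q_l t r : q = t ++ r -> t != [::] -> r ∙ [:: l] = 0.
  move=> qE t0; have [->|r0] := eqVneq r [::]; first exact: bw_nill.
  apply/eqP; apply: contraNT W0 => rl; apply/eqP; rewrite swap.
  have qp := crossesC pq; rewrite qE in cq qp q_ls *; rewrite (br_cons _ s0).
  apply: chord_through_block => //.
  by move: hs; rewrite qE size_cat; word_lia.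
have [p_att p_apart] := attached_split p_ls p_l.
have [q_att q_apart] := attached_split q_ls q_l.
have p_ge := bw_ge q_posdef p0 (chain_qw cp p0) (qw1 a l).
have p_s := bw_ge q_posdef p0 (chain_qw cp p0) qs.
have q_ge := bw_ge q_posdef q0 (chain_qw cq q0) (qw1 a l).
have q_s := bw_ge q_posdef q0 (chain_qw cq q0) qs.
have := attached_bw p_ls; have := attached_bw q_ls.
rewrite (bw_consr _ q) (bw_consr _ p) => qE pE.
rewrite (br_cons _ s0).
(* Each chain is attached to exactly one of l and s; if the choices for p and q
   agree, the bracket vanishes. *)
have [pl|pl] : p ∙ [:: l] = -1 \/ p ∙ [:: l] = 0 by word_lia.
  have [p_att_l p_apart_s] := p_att pl.
  have ps : ⁅br p, br s⁆ = 0 by apply: (monomial_comm mp ms); word_lia.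
  have [ql|ql] : q ∙ [:: l] = -1 \/ q ∙ [:: l] = 0 by word_lia.
    have sq : ⁅br s, br q⁆ = 0 by apply: (monomial_comm ms mq); rewrite ?(bwC _ s); word_lia.
    rewrite lie_lieE sq lie0r sub0r lieNr lie_centr ?oppr0 //.
    apply: (monomial_comm mp (monomial_lie ml mq)); first by move=> /=; word_lia.
    by rewrite bw_catr; word_lia.
  have [q_apart_l q_att_s] := q_apart ql.
  have lq : ⁅v l, br q⁆ = 0 by apply: (monomial_comm ml mq); rewrite 1?bwC /=; word_lia.
  rewrite lie_lieE lq lie0r subr0 lie_push; last first.
    apply: (monomial_comm mp (monomial_lie ms mq)); first by rewrite size_cat; word_lia.
    by rewrite bw_catr; word_lia.
  rewrite (lieC (br p)) lieNl -br_cons // IHs ?oppr0 //.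
  - exact: chain_cons.
  - rewrite /= p_apart_s andbT; exact/eqP.
  - exact: crosses_cons.
  - by move=> /=; word_lia.
have [p_apart_l p_att_s] := p_apart pl.
have pl0 : ⁅br p, v l⁆ = 0 by apply: (monomial_comm mp ml); move=> /=; word_lia.
have [ql|ql] : q ∙ [:: l] = -1 \/ q ∙ [:: l] = 0 by word_lia.
  have [q_att_l q_apart_s] := q_att ql.
  have sq : ⁅br s, br q⁆ = 0 by apply: (monomial_comm ms mq); rewrite ?(bwC _ s); word_lia.
  rewrite lie_lieE sq lie0r sub0r lieNr -br_cons // IHs ?oppr0 //.
  - exact: chain_cons.
  - rewrite /= q_apart_s andbT; exact/eqP.
  - exact/crossesC/crosses_cons/p_apart_l/crossesC.
  - by move=> /=; word_lia.
have lq : ⁅v l, br q⁆ = 0 by apply: (monomial_comm ml mq); rewrite 1?bwC /=; word_lia.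
rewrite lie_lieE lq lie0r subr0 lie_centr //.
apply: (monomial_comm mp (monomial_lie ms mq)); first by rewrite size_cat; word_lia.
by rewrite bw_catr; word_lia.
Qed.

(** The cycle consists of the chain t r and the composite block l s, with the +1
    edge between r and the block.  If the bracket is nonzero, then l carries
    either the +1 edge to r or the -1 edge to t: all other values of the
    products make the chain orthogonal to both l and s, or give r the weight of
    l or of s, which is the situation of [serre_middle]. *)
Lemma closing_block_cut t r l s : chain a (t ++ r) -> t != [::] ->
  r != [::] -> s != [::] -> qw s = 1 -> [:: l] ∙ s = -1 ->
  t ∙ (l :: s) = -1 -> r ∙ (l :: s) = 1 -> (size t + size r + size s < h)%N ->
  ⁅br (t ++ r), ⁅v l, br s⁆⁆ != 0 ->
  (t ++ r) ∙ [:: l] = 1 /\ r ∙ [:: l] = 1 \/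
  (t ++ r) ∙ [:: l] = -1 /\ r ∙ [:: l] = 0.
Proof.
move=> ctr t0 r0 s0 qs ls tE rE hs W0.
have [ct cr] := (chain_catl ctr, chain_catr ctr).
have [mt mr ms ml] : [/\ monomial t (br t), monomial r (br r),
    monomial s (br s) & monomial [:: l] (v l)].
  by split; try exact: monomial_br; apply: monomial_gen.
have [[zt zr] zs] := (monomial_size mt, monomial_size mr, monomial_size ms).
have [qt qr] : qw t = 1 /\ qw r = 1 by split; apply: chain_qw.
have tr := chain_cut ctr t0 r0.
have br_tr := br_cat ctr t0 r0.
rewrite bw_consr in tE; rewrite bw_consr in rE.
have [tl ts] := (bw_ge q_posdef t0 qt (qw1 a l), bw_ge q_posdef t0 qt qs).
have [rl rs] := (bw_ge q_posdef r0 qr (qw1 a l), bw_ge q_posdef r0 qr qs).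
have {}tE : t ∙ s = -1 - t ∙ [:: l] by word_lia.
have {}rE : r ∙ s = 1 - r ∙ [:: l] by word_lia.
have trl : (t ++ r) ∙ [:: l] != 0.
  apply: contra W0 => /eqP trl; apply/eqP.
  have m_tr : monomial (t ++ r) (br (t ++ r)).
    by apply: monomial_br; case: (t) t0.
  have trs : (t ++ r) ∙ s = 0 by move: trl; rewrite !bw_catl; word_lia.
  apply: lie_centr; first by apply: (monomial_comm m_tr ml); rewrite ?size_cat ?trl //=; word_lia.
  by apply: (monomial_comm m_tr ms); rewrite ?size_cat ?trs.
rewrite br_tr in W0; last word_lia.
(* A product 2 forces r to be the letter l. *)
have rl2 : r ∙ [:: l] != 2.
  apply: contra W0 => /eqP rl2; apply/eqP.
  have r_l : r = [:: l].
    by apply: perm_small_eq => //; apply: (bw_eq q_posdef); rewrite rl2 qr qw1.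
  rewrite r_l in tr hs *; rewrite (lieC (br t)) lieNl.
  rewrite (serre_middle ml mt ms) ?oppr0 ?(bwC _ [:: l] t) //; last word_lia.
  by move: hs => /=; word_lia.
(* Then r has product 2 with s, so s is a rearrangement of the chain r. *)
have rs2 : r ∙ [:: l] != -1.
  apply: contra W0 => /eqP rl1; apply/eqP.
  have sr : perm_eq s r.
    by rewrite perm_sym; apply: (bw_eq q_posdef); rewrite rE rl1 qr qs.
  have [|c ->] := br_perm_chain cr sr; first word_lia.
  have sz : size s = size r := perm_size sr; have ts_r := bw_permr a t sr.
  rewrite !lieZr (lieC (v l)) lieNr (lieC (br t)) lieNl opprK.
  rewrite (serre_middle mr mt ml) ?scaler0 ?(bwC _ r t) //; try word_lia.
  by move=> /=; word_lia.
rewrite bw_catl in trl *; word_lia.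
Qed.

(** A letter l split off the block either prolongs the chain, or takes over
    the +1 edge and becomes a second chain; [closing_block_cut] shows that the
    same alternative holds for all suffixes of the chain at once. *)
Lemma closing_block_zero s i p : s != [::] -> chain a (i :: p) ->
  p != [::] -> [:: i] ∙ s = -1 -> closes a p s ->
  (size p + size s < h)%N -> ⁅br (i :: p), br s⁆ = 0.
Proof.
elim: s i p => // l s IHs i p _ cip p0 is1 ps hs.
have [s0|s0] := eqVneq s [::].
  by rewrite s0 in is1 ps hs *; apply: closing_chain_zero.
have [mp ms ml] : [/\ monomial (i :: p) (br (i :: p)),
    monomial s (br s) & monomial [:: l] (v l)].
  by split; try exact: monomial_br; apply: monomial_gen.
have zs := monomial_size ms; rewrite /= in hs.
have [|qls1] := eqVneq (qw (l :: s)) 1; last first.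
  by rewrite (IH (monomial_br (isT : l :: s != [::]))) ?lie0r //=; word_lia.
have [qs|qs1] := eqVneq (qw s) 1; last first.
  by rewrite (br_cons _ s0) (IH ms) ?lie0r //; word_lia.
rewrite qw_cons qs => qls; have {qls} ls : [:: l] ∙ s = -1 by word_lia.
rewrite (br_cons _ s0).
have [//|W0] := eqVneq ⁅br (i :: p), ⁅v l, br s⁆⁆ 0.
have suffix t r : p = t ++ r -> r != [::] -> r ∙ (l :: s) = 1.
  by move=> pE r0; move: ps; rewrite pE => /closes_suffix[].
have cut t r : p = t ++ r -> r != [::] ->
    (i :: p) ∙ [:: l] = 1 /\ r ∙ [:: l] = 1 \/
    (i :: p) ∙ [:: l] = -1 /\ r ∙ [:: l] = 0.
  move=> pE r0; rewrite pE -cat_cons.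
  apply: (closing_block_cut (s := s)) => //; rewrite ?cat_cons -?pE //.
  - rewrite bw_consl is1; move: ps; rewrite pE => /closes_suffix-/(_ r0)[/apart_bw-> _].
    by rewrite addr0.
  - exact: suffix pE r0.
  - by move: hs; rewrite pE size_cat /=; word_lia.
have := closes_bw ps; rewrite bw_consr => pE; rewrite bw_consr in is1.
have [[ipl pl]|[ipl pl]] := cut [::] p erefl p0.
  have il : [:: i] ∙ [:: l] = 0 by move: ipl; rewrite bw_consl pl; word_lia.
  have p_l : closes a p [:: l].
    by apply: closes_of_suffixes => // t r rE r0; have := cut t r rE r0; rewrite ipl; word_lia.
  have p_s : apart a p s.
    apply: apart_of_suffixes => t r rE.
    have [->|r0] := eqVneq r [::]; first exact: bw_nill.
    by have := suffix t r rE r0; rewrite bw_consr; have := cut t r rE r0; rewrite ipl; word_lia.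
  rewrite (lieC (v l)) lieNr (two_chains_zero (q := [:: l])) ?oppr0 //.
  - by rewrite /= p_s andbT; apply/eqP; word_lia.
  - by rewrite /= ls eqxx.
  - by apply: closes_crosses; apply: closes_cons.
  - by move=> /=; word_lia.
have il : [:: i] ∙ [:: l] = -1 by move: ipl; rewrite bw_consl pl; word_lia.
have p_l : apart a p [:: l].
  apply: apart_of_suffixes => t r rE.
  have [->|r0] := eqVneq r [::]; first exact: bw_nill.
  by have := cut t r rE r0; rewrite ipl; word_lia.
have p_s : closes a p s.
  apply: closes_of_suffixes => // t r rE r0.
  by have := suffix t r rE r0; rewrite bw_consr; have := cut t r rE r0; rewrite ipl; word_lia.
have is0 : [:: i] ∙ s = 0 by word_lia.
rewrite lie_push; last first.
  apply: (monomial_comm mp ms); first by move=> /=; word_lia.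
  by rewrite bw_consl is0 (closes_bw p_s).
rewrite (lieC (br _)) lieNl -br_cons // IHs ?oppr0 //.
- by apply: chain_cons; rewrite //= il eqxx.
- exact: closes_cons.
- by move=> /=; word_lia.
Qed.

(** The relation [v_i, [v_i, v_j]] = 0 propagates from letters to roots t with
    i.t = -1, because i is joined to exactly one of the two parts of t = k u. *)
Lemma lie_twice_zero i t : t != [::] -> qw t = 1 -> [:: i] ∙ t = -1 ->
  (size t + 2 <= h)%N -> ⁅v i, ⁅v i, br t⁆⁆ = 0.
Proof.
case: t => // k t _ qkt ikt hs; rewrite /= in hs.
have [t0|t0] := eqVneq t [::]; first by rewrite t0 in ikt *; apply: v_serre.
have [[mi mk] mt] := (monomial_gen i, monomial_gen k, monomial_br t0).
have zt := monomial_size mt.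
have [qt|qt] := eqVneq (qw t) 1; last first.
  by rewrite br_cons // (IH mt) ?lie0r //; word_lia.
have it_ge := bw_ge q_posdef (isT : [:: i] != [::]) (qw1 a i) qt.
have ik_ge := bw_ge q_posdef (isT : [:: i] != [::]) (qw1 a i) (qw1 a k).
rewrite bw_consr in ikt; rewrite br_cons //.
have [ik|ik] : [:: i] ∙ [:: k] = -1 \/ [:: i] ∙ [:: k] = 0 by word_lia.
  have it : ⁅v i, br t⁆ = 0 by apply: (monomial_comm mi mt) => /=; word_lia.
  by rewrite !(lie_push _ it) v_serre // lie0l.
rewrite (lie_swap (y := v k)); last by apply: v_comm; rewrite ik.
rewrite lie_swap; last by apply: v_comm; rewrite ik.
rewrite (monomial_comm mi (monomial_lie mi mt)) ?lie0r //=; first word_lia.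
by rewrite bw_consr bw_diag qw1; word_lia.
Qed.

(** For the word i j t the products i.j and i.t lie between -1 and 2, and the
    hypothesis says that they do not add up to -1. *)
Lemma br_zero s : size s = h -> qw s != 1 -> br s = 0.
Proof.
case: s => // i s; have [->|s0] := eqVneq s [::]; first by rewrite qw1 eqxx.
rewrite br_cons // => hs; rewrite qw_cons => qis.
have [mi ms] := (monomial_gen i, monomial_br s0).
have [qs|qs] := eqVneq (qw s) 1; last by rewrite (IH ms) ?lie0r // -hs.
rewrite qs in qis; rewrite /= in hs.
case: s s0 ms qs hs qis => // j t _ ms qs hs qis.
have [t0|t0] := eqVneq t [::].
  by rewrite (t0 : t = [::]) in qis *; apply: v_comm; word_lia.
have [mj mt] := (monomial_gen j, monomial_br t0); have zt := monomial_size mt.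
rewrite /= in hs.
have [qt|qt] := eqVneq (qw t) 1; last first.
  by rewrite br_cons // (IH mt) ?lie0r //; word_lia.
have jt : [:: j] ∙ t = -1 by move: qs; rewrite qw_cons qt; word_lia.
have it_ge := bw_ge q_posdef (isT : [:: i] != [::]) (qw1 a i) qt.
have ij_ge := bw_ge q_posdef (isT : [:: i] != [::]) (qw1 a i) (qw1 a j).
have ijt_ge := bw_ge q_posdef (isT : [:: i] != [::]) (qw1 a i) qs.
have it_le := bw_le q_posdef [:: i] t.
have ij_le := bw_le q_posdef [:: i] [:: j].
rewrite ?qw1 ?qt in it_le ij_le.
rewrite bw_consr in qis ijt_ge; rewrite br_cons //.
have [ij1|ij1] := eqVneq ([:: i] ∙ [:: j]) (-1).
  have it_zero : ⁅v i, br t⁆ = 0 by apply: (monomial_comm mi mt) => /=; word_lia.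
  have [it2|it2] := eqVneq ([:: i] ∙ t) 2.
    have <- : [:: i] = t.
      apply/esym/perm_small_eq => //; rewrite perm_sym.
      by apply: (bw_eq q_posdef); rewrite it2 qw1 qt.
    by rewrite (lieC (v j)) lieNr v_serre ?oppr0.
  rewrite lie_push // (lieC (v i)) lieNl.
  rewrite (@closing_block_zero t j [:: i]) ?oppr0 //=.
  - by rewrite ij1 eqxx.
  - by exists [::], i; split=> //; move: it2; word_lia.
  - by word_lia.
have [it1|it1] := eqVneq ([:: i] ∙ t) (-1); last first.
  by apply: lie_centr; [apply: v_comm | apply: (monomial_comm mi mt) => //=; word_lia].
have [ij2|ij2] := eqVneq ([:: i] ∙ [:: j]) 2.
  have /perm_small_eq-/(_ isT) [->] : perm_eq [:: j] [:: i].
    by rewrite perm_sym; apply: (bw_eq q_posdef); rewrite ij2 !qw1.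
  by apply: lie_twice_zero => //; word_lia.
have ij : [:: i] ∙ [:: j] = 1 by move: ij1 ij2 qis; word_lia.
rewrite (lieC (v j)) lieNr (@two_chains_zero t [:: i] [:: j]) ?oppr0 //=.
- by rewrite it1 eqxx.
- by rewrite jt eqxx.
- by apply: closes_crosses; exists [::], i.
- by word_lia.
Qed.

End Step.

Lemma monomial_zero s x : monomial s x -> qw s != 1 -> x = 0.
Proof.
have [m] := ubnP (size s); elim: m s x => // m IHm s x; rewrite ltnS => sm mx qs.
have IH t y : monomial t y -> (size t < size s)%N -> qw t != 1 -> y = 0.
  by move=> my ts; apply: IHm my; apply: leq_trans ts sm.
apply: (monomial_span mx (Z := fun y => y = 0)) => // [y z -> ->|t ts].
  by rewrite subr0.
by apply: (br_zero IH); [apply: perm_size | rewrite (qw_perm a ts)].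
Qed.

End Reduction.

(** * Roots *)

Section Roots.
Variables (n : nat) (a : 'I_n -> 'I_n -> int).
Implicit Types (i j : 'I_n) (s : seq 'I_n).
Local Notation "s ∙ t" := (bw a s t) (at level 40).
Local Notation q := (unit_form a).

Lemma is_root1 i : is_root q [:: i].
Proof. by split=> // k; rewrite /= ltnS ltn0. Qed.

(** Roots can be recognised one letter at a time. *)
Lemma is_root_cons i s : s != [::] ->
  is_root q (i :: s) <-> [:: i] ∙ s = -1 /\ is_root q s.
Proof.
move=> s0; split=> [[_ rs]|[is1 [_ rs]]].
  split; first by have := rs ord0; rewrite /= ltnS lt0n size_eq0 drop0 /bw weight1; apply.
  split=> [|k ks]; first by case: (s) s0.
  by have := rs (lift ord0 k) ks; rewrite (tnth_nth i) (tnth_nth i).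
split=> // -[[|k] ks] /= ks'; first by rewrite (tnth_nth i) drop0 -(weight1 i).
by have := rs (Ordinal (ks : (k < size s)%N)) ks'; rewrite !(tnth_nth i).
Qed.

Lemma is_root_qw s : is_root q s -> qw a s = 1.
Proof.
elim: s => [[]//|i s IHs]; have [-> _|s0] := eqVneq s [::]; first exact: qw1.
by case/(is_root_cons _ s0) => is1 /IHs qs; rewrite qw_cons is1 qs.
Qed.

Lemma not_root_qw i s : is_root q s -> ~ is_root q (i :: s) ->
  qw a (i :: s) != 1.
Proof.
move=> rs nrs; have s0 : s != [::] by case: (s) rs => // -[].
rewrite qw_cons (is_root_qw rs); apply/eqP => qis; apply: nrs.
by apply/(is_root_cons _ s0); split=> //; lia.
Qed.

Lemma qw_not_root s : qw a s != 1 -> ~ is_root q s.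
Proof. by move=> qs rs; move: qs; rewrite is_root_qw. Qed.

Lemma chain_is_root s : s != [::] -> chain a s -> is_root q s.
Proof.
elim: s => // i s IHs _ cis; have [->|s0] := eqVneq s [::]; first exact: is_root1.
apply/(is_root_cons _ s0); split; first exact: (chain_cut (s := [:: i]) cis).
by apply: IHs => //; case/andP: cis.
Qed.

End Roots.

(** * Comparison of the two ideals *)

Section Ideals.
Variables (K : fieldType).

Lemma lie_ideal_ext (L : lieAlgType K) (I J : lieIdeal L) :
  (forall x, I x <-> J x) -> I = J.
Proof.
case: I J => I I_ideal [J J_ideal] /= IJ.
have IJ' : I = J by apply/funext => x; apply/propext.
by rewrite {}IJ' in I_ideal IJ *; congr LieIdeal; apply: Prop_irrelevance.
Qed.

Lemma ideal_gen_mem (L : lieAlgType K) (S : set L) x : S x -> ideal_gen S x.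
Proof. by move=> Sx I [_]; apply. Qed.

Lemma ideal_gen_min (L : lieAlgType K) (S : set L) (I : lieIdeal L) :
  (forall x, S x -> I x) -> forall x, ideal_gen S x -> I x.
Proof. by move=> SI x; apply; split; [exact: ideal_setP | exact: SI]. Qed.

Lemma multibracket_morph (L L' : lieAlgType K) (f : L -> L') s :
  lie_morphism f -> f (multibracket s) = multibracket (map f s).
Proof.
case=> f_lin f_lie; elim: s => [|x [|y s] IHs] //.
  have := f_lin 1 0 0; rewrite !scale1r addr0.
  by move/esym/(canRL (addrK _)); rewrite subrr.
by rewrite /= f_lie -/(multibracket (y :: s)) IHs.
Qed.

Variables (n : nat) (a : 'I_n -> 'I_n -> int).
Implicit Types (i j : 'I_n) (s : seq 'I_n).
Local Notation "s ∙ t" := (bw a s t) (at level 40).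
Local Notation q := (unit_form a).
Local Notation vgen := (@vgen K n).
Local Notation vbracket := (@vbracket K n).

Hypothesis q_posdef : positive_definite q.
Hypothesis two_neq0 : 2 != 0 :> K.

Lemma rel_r_mem i s : is_root q s -> qw a (i :: s) != 1 ->
  ideal_gen (rel_r K q) (vbracket (i :: s)).
Proof.
by move=> rs qis; apply: ideal_gen_mem; exists i, s; split=> //; apply: qw_not_root.
Qed.

Lemma rel_j_sub_r x : rel_j K a x -> ideal_gen (rel_r K q) x.
Proof.
have aE (i j : 'I_n) : (i < j)%N -> [:: i] ∙ [:: j] = a i j.
  by move=> ij; rewrite /bw !weight1 bform_ebasis.
have root2 (i j : 'I_n) : [:: i] ∙ [:: j] = -1 -> is_root q [:: i; j].
  by move=> ij; apply/is_root_cons => //; split=> //; apply: is_root1.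
case=> [[[[i [j [ij aij ->]]]|[i [j [ij aij ->]]]]|[i [j [ij aij ->]]]]|].
- apply: (@rel_r_mem i [:: j]); first exact: is_root1.
  by rewrite qw_cons qw1 aE //; lia.
- apply: (@rel_r_mem i [:: i; j]); first by apply: root2; rewrite aE.
  by rewrite 2!qw_cons qw1 (bw_consr a [:: i] i [:: j]) bw_diag qw1 aE // aij.
- rewrite (lieC (vgen i)) lieNr; apply: (@lie_idealN _ _ (ideal_gen _)).
  apply: (@rel_r_mem j [:: j; i]).
    by apply: root2; rewrite bwC aE.
  by rewrite 2!qw_cons qw1 (bw_consr a [:: j] j [:: i]) bw_diag qw1 bwC aE // aij.
case=> m [c [/positive_cycle_chains [i [s [j [s0 -> cis csj ij]]]] ->]].
apply: (@rel_r_mem i (rcons s j)).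
  by apply: chain_is_root csj; case: (s).
rewrite -cats1 qw_cons bw_catr ij cats1 (chain_qw csj); last by case: (s).
by rewrite (chain_cut (s := [:: i]) cis).
Qed.

(** The quotient by the second ideal satisfies the relations under which
    monomials that are not roots vanish. *)
Lemma rel_r_sub_j x : rel_r K q x -> ideal_gen (rel_j K a) x.
Proof.
case=> i [s [nis rs ->]]; apply/lie_pi_eq0; set J := ideal_gen _.
have memJ y : rel_j K a y -> lie_pi J y = 0.
  by move=> yj; apply/lie_pi_eq0; apply: ideal_gen_mem.
have pi_mor := lie_pi_morphism J; have pi_lie := pi_mor.2.
rewrite (multibracket_morph _ pi_mor) -map_comp -/(br _ (i :: s)).
have aE (k l : 'I_n) : (k < l)%N -> [:: k] ∙ [:: l] = a k l.
  by move=> kl; rewrite /bw !weight1 bform_ebasis.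
have pi0 : lie_pi J 0 = 0 := lie_pi0 J.
have piN y : lie_pi J y = 0 -> lie_pi J (- y) = 0.
  by move/lie_pi_eq0/lie_idealN/lie_pi_eq0.
apply: (monomial_zero q_posdef two_neq0) (monomial_br _ _) (not_root_qw rs nis) => //.
- move=> k l; rewrite /= -pi_lie; case: (ltngtP k l) => [kl|lk|/val_inj->] kl1.
  + by apply: memJ; left; left; left; exists k, l; rewrite -aE.
  + rewrite lieC; apply/piN/memJ.
    by left; left; left; exists l, k; rewrite -aE // bwC.
  + by rewrite liexx.
- move=> k l /=; rewrite -!pi_lie; case: (ltngtP k l) => [kl|lk|/val_inj->] kl1.
  + by apply: memJ; left; left; right; exists k, l; rewrite -aE.
  + rewrite (lieC (vgen k) (vgen l)) lieNr; apply/piN/memJ.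
    by left; right; exists l, k; rewrite -aE // bwC.
  + by move: kl1; rewrite bw_diag qw1.
- move=> m c c_cycle; rewrite map_comp -(multibracket_morph _ pi_mor).
  by apply: memJ; right; exists m, c.
Qed.

Lemma ideal_gen_rel_r : ideal_gen (rel_r K q) = ideal_gen (rel_j K a).
Proof.
apply: lie_ideal_ext => x; split.
  exact: ideal_gen_min rel_r_sub_j x.
exact: ideal_gen_min rel_j_sub_r x.
Qed.

End Ideals.

Theorem theorem1p1 (R : realType) (n : nat) (a : 'I_n -> 'I_n -> int)
    (a_unit : forall i j : 'I_n, (i < j)%N -> a i j \in [:: -1; 0; 1])
    (q_posdef : positive_definite (unit_form a))
    (q_connected : form_connected a) :
  lie_isomorphic (lie_quot (ideal_gen (rel_r R[i] (unit_form a))))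
                 (lie_quot (ideal_gen (rel_j R[i] a))).
Proof.
rewrite (ideal_gen_rel_r q_posdef) ?pnatr_eq0 //.
by exists id; split; [split | exists id].
Qed.
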